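(* For large enough integers $d,n$ with $\omega(\log n)=d\leq n$, there is a polynomial $G_{n,d}(X)$ which is set-multilinear over the variable partition $X=(X_1,\ldots,X_d)$ with each $|X_i|\leq n$, such that: (i) $G_{n,d}$ has an algebraic branching program of size $\mathrm{poly}(n)$; but (ii) any $\sum\mathsf{smABP}$ of max-width $\mathrm{poly}(n)$ computing $G_{n,d}$ requires total-width $2^{\Omega(d)}$.
   Context: An algebraic branching program (ABP) is a layered DAG with a start node and an end node, edges between consecutive layers labelled by linear polynomials, computing the sum over start-to-end paths of the product of edge labels; its size is its number of nodes. A polynomial is set-multilinear with respect to a partition $(X_1,\ldots,X_d)$ if every monomial contains exactly one variable from each $X_i$. A set-multilinear ABP of depth $d$ is ordered with respect to $\sigma\in S_d$ if every edge from layer $\ell-1$ to layer $\ell$ is labelled by a linear form in the variables of $X_{\sigma(\ell)}$; its width is the maximum number of nodes in a layer. A $\sum\mathsf{smABP}$ computing $P$ is an expression $\sum_{i=1}^t A_i=P$ with each $A_i$ a set-multilinear ABP ordered with respect to some permutation $\sigma_i$; its max-width is the maximum width of the $A_i$ and its total-width is the sum of the widths. *)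

(* Defs.v *)
From HB Require Import structures.
From mathcomp Require Import all_boot all_order all_algebra all_fingroup.
From mathcomp Require Import mpoly.
Set Implicit Arguments. Unset Strict Implicit. Unset Printing Implicit Defensive.
Import GRing.Theory.
Local Open Scope ring_scope.

(* Variables: x_0, ..., x_{m-1} of {mpoly F[m]}.  A variable partition
   (X_1,...,X_d) is given by a block map blk : 'I_m -> 'I_d
   (X_i = [set j | blk j == i]). *)

Definition blocks_bounded (m d n : nat) (blk : 'I_m -> 'I_d) : Prop :=
  forall i : 'I_d, (#|[set j | blk j == i]| <= n)%N.

Definition set_multilinear (F : fieldType) (m d : nat) (blk : 'I_m -> 'I_d)
  (P : {mpoly F[m]}) : Prop :=
  forall mo : 'X_{1..m}, mo \in msupp P ->
    forall i : 'I_d, (\sum_(j < m | blk j == i) mo j)%N = 1%N.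

Definition linform_in (F : fieldType) (m d : nat) (blk : 'I_m -> 'I_d)
  (i : 'I_d) (p : {mpoly F[m]}) : Prop :=
  exists a : 'I_m -> F, p = \sum_(j < m | blk j == i) a j *: 'X_j.

Definition mxpow (R : pzRingType) (s : nat) (M : 'M[R]_s) (k : nat) : 'M[R]_s :=
  iter k (fun B => B *m M) 1%:M.

(* General ABP: nodes 'I_s with layers lay; start node src in layer 0, end
   node snk in the last layer L = lay snk; lab u v is the label of edge u->v
   (0 = no edge); edges only go from a layer to the next one and are labelled
   by linear (degree <= 1) polynomials. *)
Record ABP (F : fieldType) (m : nat) := {
  abp_s : nat;
  abp_lay : 'I_abp_s -> nat;
  abp_src : 'I_abp_s;
  abp_snk : 'I_abp_s;
  abp_lab : 'I_abp_s -> 'I_abp_s -> {mpoly F[m]};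
  abp_src_lay : abp_lay abp_src = 0%N;
  abp_first : forall v, abp_lay v = 0%N -> v = abp_src;
  abp_last : forall v, abp_lay v = abp_lay abp_snk -> v = abp_snk;
  abp_bounded : forall v, (abp_lay v <= abp_lay abp_snk)%N;
  abp_edges : forall u v, abp_lab u v = 0 \/
     (abp_lay v = (abp_lay u).+1 /\ (msize (abp_lab u v) <= 2)%N)
}.

Definition abp_size F m (A : ABP F m) : nat := abp_s A.

(* sum over start-to-end paths of the product of edge labels *)
Definition abp_poly F m (A : ABP F m) : {mpoly F[m]} :=
  mxpow (\matrix_(u, v) @abp_lab F m A u v) (abp_lay (abp_snk A)) (abp_src A) (abp_snk A).

Record smABP (F : fieldType) (m d : nat) (blk : 'I_m -> 'I_d) := {
  sm_s : nat;
  sm_sigma : 'S_d;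
  sm_lay : 'I_sm_s -> 'I_d.+1;
  sm_src : 'I_sm_s;
  sm_snk : 'I_sm_s;
  sm_lab : 'I_sm_s -> 'I_sm_s -> {mpoly F[m]};
  sm_first : forall v, sm_lay v = ord0 <-> v = sm_src;
  sm_last : forall v, sm_lay v = ord_max <-> v = sm_snk;
  sm_edges : forall u v, sm_lab u v = 0 \/
     exists l : 'I_d, [/\ nat_of_ord (sm_lay u) = nat_of_ord l,
                          nat_of_ord (sm_lay v) = l.+1 &
                          linform_in blk (sm_sigma l) (sm_lab u v)]
}.

Definition sm_width F m d (blk : 'I_m -> 'I_d) (A : smABP F blk) : nat :=
  (\max_(l < d.+1) #|[set v | @sm_lay F m d blk A v == l]|)%N.

Definition sm_poly F m d (blk : 'I_m -> 'I_d) (A : smABP F blk) : {mpoly F[m]} :=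
  mxpow (\matrix_(u, v) @sm_lab F m d blk A u v) d (sm_src A) (sm_snk A).

Definition sum_poly F m d (blk : 'I_m -> 'I_d) (As : seq (smABP F blk)) : {mpoly F[m]} :=
  \sum_(A <- As) sm_poly A.
Definition max_width F m d (blk : 'I_m -> 'I_d) (As : seq (smABP F blk)) : nat :=
  (\max_(A <- As) sm_width A)%N.
Definition total_width F m d (blk : 'I_m -> 'I_d) (As : seq (smABP F blk)) : nat :=
  (\sum_(A <- As) sm_width A)%N.

(* Main.v *)
Require Import Defs.
From mathcomp Require Import all_boot all_order all_algebra all_fingroup.
From mathcomp Require Import mpoly zify ring.

(** Put h = d/3 and give three blocks x_u, y_u, l_u to every u < h, the few
    remaining blocks being padding.  The hard polynomial is the determinant of
    the matrix with entries l_(u,v) * sum_i x_(u,i) y_(v,i), times one linear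
    form per padding block.  It has a small branching program because the
    characteristic polynomial of a matrix is obtained from that of its lower
    right block by a Schur complement, and every product in this recurrence has
    an entry of the matrix as a factor.

    For the lower bound, colour the x- and y-blocks with two colours.  If the
    colouring is balanced there is a permutation pi such that x_u and y_(pi u)
    always have different colours; freezing the l-blocks to pi turns the
    coefficient matrix (first colour against second colour) of the hard
    polynomial into plus or minus the identity of size n^h.  On the other hand,
    cutting an ordered program of width w into windows of 2M x- or y-blocks
    bounds the rank of its coefficient matrix by w to the number of windows
    times n to the sum of the minority colour counts of the windows.  For M
    large in terms of k this is at most n^(h-q), q = h/M, for all but a fraction
    2^(-q) of the colourings, whereas a fraction at least 1/(2h) of them is
    balanced.  So a sum of fewer than 2^q/(2h) programs cannot have the rank of
    the hard polynomial. *)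

Set Implicit Arguments. Unset Strict Implicit. Unset Printing Implicit Defensive.
Import GRing.Theory.

(** * Counting two-colourings *)

Lemma central_bin_rec m :
  (m.+1 * 'C(m.+1.*2, m.+1) = 2 * m.*2.+1 * 'C(m.*2, m))%N.
Proof.
have h1 := mul_bin_diag m.*2.+1 m; rewrite /= in h1.
have h2 : 'C(m.*2.+1, m) = 'C(m.*2.+1, m.+1).
  by rewrite -bin_sub; [congr 'C(_, _)|]; lia.
rewrite doubleS binS h2; nia.
Qed.

Lemma central_bin_lower h : (0 < h)%N -> (4 ^ h <= 2 * h * 'C(h.*2, h))%N.
Proof.
elim: h => // -[|h] IH _ //.
have := central_bin_rec h.+1; have := IH isT; rewrite [(4 ^ h.+2)%N]expnS.
set x := 'C(h.+2.*2, _); set y := 'C(h.+1.*2, _); set z := (4 ^ h.+1)%N; nia.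
Qed.

(** The squared form of C(2m,m) <= 4^m / sqrt(2m+1), which stays within the integers. The induction
    closes because (2m+1)(2m+3) <= 4(m+1)^2. *)
Lemma central_bin_upper m : ('C(m.*2, m) ^ 2 * m.*2.+1 <= 16 ^ m)%N.
Proof.
elim: m => [|m IH]; first by rewrite bin0.
rewrite -(leq_pmul2l (_ : 0 < m.+1 ^ 2)%N) ?expn_gt0 // mulnA -expnMn.
rewrite central_bin_rec [(16 ^ m.+1)%N]expnS.
move: IH; set y := 'C(m.*2, m); set z := (16 ^ m)%N => IH.
have -> : ((2 * m.*2.+1 * y) ^ 2 * m.+1.*2.+1
   = 4 * (m.*2.+1 * m.+1.*2.+1) * (y ^ 2 * m.*2.+1))%N.
  by rewrite !expnMn; nia.
rewrite (mulnCA (m.+1 ^ 2)%N).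
apply: (@leq_trans (4 * (4 * m.+1 ^ 2) * (y ^ 2 * m.*2.+1))%N); last by nia.
by rewrite leq_mul2r leq_mul2l; apply/orP; right; rewrite -!muln2; nia.
Qed.

Lemma central_bin_max m j : ('C(m.*2, j) <= 'C(m.*2, m))%N.
Proof.
have lo i : (i <= m)%N -> ('C(m.*2, m - i) <= 'C(m.*2, m))%N.
  elim: i => [|i IH] im; first by rewrite subn0.
  apply: leq_trans (IH (ltnW im)).
  have := mul_bin_left m.*2 (m - i.+1); rewrite -subSn // subSS.
  have -> : (m.*2 - (m - i.+1) = m + i.+1)%N by lia.
  set x := 'C(_, _); set y := 'C(_, _); nia.
case: (leqP j m) => jm; first by rewrite -[j](subKn jm) lo // leq_subr.
case: (leqP j m.*2) => j2; last by rewrite bin_small.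
rewrite -bin_sub //; have -> : (m.*2 - j = m - (j - m))%N by lia.
by apply: lo; lia.
Qed.

Lemma central_bin_small T : exists m : nat, (0 < m)%N /\ ('C(m.*2, m) * 2 ^ T <= 4 ^ m)%N.
Proof.
(* C(2m,m) / 4^m is at most 1/sqrt(2m+1), and [m = 4 ^ T] brings this below 2^-T. *)
exists (4 ^ T)%N; rewrite expn_gt0; split=> //.
set m := (4 ^ T)%N; rewrite -(leq_exp2r _ _ (isT : 0 < 2)%N) expnMn -!expnM.
apply: leq_trans (leq_trans (central_bin_upper m) _); last first.
  by rewrite mulnC expnM.
rewrite leq_mul2l; apply/orP; right.
by rewrite mulnC expnM -/m; lia.
Qed.

(** Up to [a = m] the summands form a geometric series, and beyond it they run back down; the two
    parts stay below 2 * 2^m and 2^m. *)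
Lemma sum_pow_min m : (\sum_(a < m.*2.+1) 2 ^ minn a (m.*2 - a) <= 4 * 2 ^ m)%N.
Proof.
have geo k : (\sum_(a < k) 2 ^ a < 2 ^ k)%N.
  elim: k => [|k IH]; first by rewrite big_ord0.
  by rewrite big_ord_recr /= expnS mul2n -addnn -addSn leq_add2r.
have -> : m.*2.+1 = (m.+1 + m)%N by lia.
rewrite big_split_ord /=.
have h1 := geo m.+1; have h2 := geo m; rewrite expnS in h1.
rewrite (reindex_inj rev_ord_inj) /= in h2.
have e1 : (\sum_(i < m.+1) 2 ^ minn i (m.*2 - i) <= \sum_(i < m.+1) 2 ^ i)%N.
  by apply: leq_sum => i _; rewrite leq_pexp2l // geq_minl.
have e2 : (\sum_(i < m) 2 ^ minn (m.+1 + i) (m.*2 - (m.+1 + i)) <=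
           \sum_(i < m) 2 ^ (m - i.+1))%N.
  by apply: leq_sum => i _; rewrite leq_pexp2l //; have := ltn_ord i; lia.
apply: leq_trans (leq_add e1 e2) (leq_trans (leq_add (ltnW h1) (ltnW h2)) _).
by lia.
Qed.

Section Colourings.
Variable T : finType.
Implicit Types (S U c : {set T}) (Ss : seq {set T}).

(** The exponent of [n] in the rank bound for a window [S]: rows or columns are sorted by the
    coordinates of whichever colour is rarer in [S]. *)
Definition minority c S := minn #|c :&: S| #|S :\: c|.

Lemma minority_half c S : (2 * minority c S <= #|S|)%N.
Proof. by rewrite -(cardsID c S) setIC /minority; lia. Qed.

(** The colourings with [a] elements contribute C(2m,a) 2^min(a,2m-a); replacing C(2m,a) by the
    central coefficient leaves [sum_pow_min]. *)
Lemma sum_pow_minority m S : #|S| = m.*2 ->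
  (\sum_(c : {set T} | c \subset S) 2 ^ minority c S <= 4 * 2 ^ m * 'C(m.*2, m))%N.
Proof.
move=> Sm.
have key (c : {set T}) : c \subset S -> minority c S = minn #|c| (m.*2 - #|c|).
  by move=> cS; rewrite /minority (setIidPl cS) cardsDS // Sm.
rewrite (eq_bigr _ (fun c cS => congr1 (expn 2) (key c cS))).
rewrite (partition_big (fun c : {set T} => inord #|c| : 'I_m.*2.+1) xpredT) //=.
apply: (@leq_trans (\sum_(a < m.*2.+1) 2 ^ minn a (m.*2 - a) * 'C(m.*2, m))%N);
  last by rewrite -big_distrl /= leq_mul2r sum_pow_min orbT.
apply: leq_sum => a _.
have cardE (c : {set T}) : c \subset S -> inord #|c| = a :> 'I_m.*2.+1 -> #|c| = a.
  by move=> /subset_leq_card; rewrite Sm => h <-; rewrite inordK.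
rewrite (eq_bigr (fun=> 2 ^ minn a (m.*2 - a))%N); last first.
  by move=> c /andP[cS /eqP ca]; rewrite (cardE c).
rewrite sum_nat_const mulnC leq_mul2l; apply/orP; right.
apply: leq_trans (central_bin_max m a).
have <- : #|[set A : {set T} | A \subset S & #|A| == a]| = 'C(m.*2, a) by rewrite cards_draws Sm.
apply: subset_leq_card; apply/subsetP => c; rewrite unfold_in => /andP[cS /eqP ca].
by rewrite inE cS (cardE c cS ca) eqxx.
Qed.

(** Independence: a subset of [U] is a free choice inside [S] together with a free choice
    outside. *)
Lemma sum_subset_split S U (F H : {set T} -> nat) : S \subset U ->
  (\sum_(c : {set T} | c \subset U) F (c :&: S) * H (c :\: S) =
   (\sum_(a : {set T} | a \subset S) F a) *
   (\sum_(b : {set T} | b \subset U :\: S) H b))%N.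
Proof.
move=> SU; rewrite big_distrlr /= pair_big /=.
rewrite (reindex_onto (fun p : {set T} * {set T} => p.1 :|: p.2)
  (fun c => (c :&: S, c :\: S))) /=; last first.
  by move=> c _; rewrite setID.
have red (a b : {set T}) : a \subset S -> b \subset U :\: S ->
    (a :|: b) :&: S = a /\ (a :|: b) :\: S = b.
  rewrite subsetD => aS /andP[bU bS].
  rewrite setIUl setDUl (setIidPl aS) (disjoint_setI0 bS) setU0.
  split=> //; move: aS; rewrite -setD_eq0 => /eqP ->.
  by rewrite set0U; apply/setDidPl.
apply: eq_big => [[a b]|[a b]] /=.
  apply/andP/andP => [[ab /eqP[ea eb]]|[aS bU]].
    by split; [rewrite -ea subsetIr | rewrite -eb setSD].
  have [-> ->] := red a b aS bU; split=> //.
  rewrite subUset (subset_trans aS SU).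
  by apply: subset_trans bU (subsetDl _ _).
case/andP => ab /eqP[ea eb].
have aS : a \subset S by rewrite -ea subsetIr.
have bU : b \subset U :\: S by rewrite -eb setSD.
by have [-> ->] := red a b aS bU.
Qed.

Lemma minority_setI c S : minority (c :&: S) S = minority c S.
Proof. by rewrite /minority -setIA setIid setDIr setDv setU0. Qed.

Lemma minority_setD c S S' : [disjoint S & S'] -> minority (c :\: S) S' = minority c S'.
Proof.
move=> dis; rewrite /minority.
have e : S' :&: S = set0 by rewrite setIC; apply: disjoint_setI0.
rewrite setIDAC -setIDA; have -> : S' :\: S = S' by apply/setDidPl; rewrite disjoint_sym.
by rewrite setDDr e setU0.
Qed.

(** Under a uniform colouring the minorities of disjoint sets are independent, so the mean of the
    product is bounded by the product of the one-set bounds [sum_pow_minority]. Denominators are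
    cleared. *)
Lemma sum_prod_minority m Ss U :
  pairwise (fun S S' => [disjoint S & S']) Ss ->
  all (fun S => S \subset U) Ss -> all (fun S => #|S| == m.*2) Ss ->
  ((\sum_(c : {set T} | c \subset U) \prod_(S <- Ss) 2 ^ minority c S) * 4 ^ (m * size Ss)
    <= 2 ^ #|U| * (4 * 2 ^ m * 'C(m.*2, m)) ^ size Ss)%N.
Proof.
elim: Ss U => [|S Ss IH] U /=.
  move=> _ _ _; rewrite muln0 expn0 !muln1.
  under eq_bigr do rewrite big_nil.
  rewrite -card_powerset -sum1_card; apply/eq_leq/eq_bigl => c.
  by rewrite powersetE.
move=> /andP[/allP dS dis] /andP[SU /allP Us] /andP[/eqP Sm cs].
have eqF c : c \subset U -> (\prod_(S' <- S :: Ss) 2 ^ minority c S' =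
    2 ^ minority (c :&: S) S * \prod_(S' <- Ss) 2 ^ minority (c :\: S) S')%N.
  move=> _; rewrite big_cons minority_setI; congr muln.
  by rewrite !big_seq; apply: eq_bigr => S' S's; rewrite minority_setD // dS.
rewrite (eq_bigr _ eqF) (sum_subset_split (fun a => 2 ^ minority a S)%N
  (fun b => \prod_(S' <- Ss) 2 ^ minority b S')%N SU).
have {IH} := IH (U :\: S) dis _ cs.
have -> /= : all (fun S0 : {set T} => S0 \subset U :\: S) Ss.
  apply/allP => S' S's; rewrite subsetD Us //= disjoint_sym; exact: dS.
move=> /(_ isT) IH.
rewrite mulnS expnD [(_ ^ (size Ss).+1)%N]expnS.
have -> : #|U| = (m.*2 + #|U :\: S|)%N.
  by rewrite cardsDS // Sm subnKC // -Sm subset_leq_card.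
have -> : (4 ^ m = 2 ^ m.*2)%N by rewrite -mul2n expnM.
have := leq_mul (sum_pow_minority Sm) IH; rewrite expnD.
set C := (4 * _ * _)%N => h; rewrite -[leqRHS]mulnA [(_ * (_ * _ ^ _))%N]mulnCA.
by rewrite leq_mul2l; apply/orP; right; rewrite [leqRHS]mulnCA -[leqLHS]mulnA.
Qed.

(* Markov's inequality for the weight 2^(sum of minorities). *)
Lemma card_high_minority m t Ss :
  ('C(m.*2, m) * 2 ^ t.+3 <= 4 ^ m)%N ->
  pairwise (fun S S' => [disjoint S & S']) Ss ->
  all (fun S => #|S| == m.*2) Ss ->
  (#|[set c : {set T} | m * size Ss <= \sum_(S <- Ss) minority c S + t * size Ss]|
     * 2 ^ size Ss <= 2 ^ #|T|)%N.
Proof.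
move=> hm dis cs.
have allT : all (fun S : {set T} => S \subset [set: T]) Ss by apply/allP => S _; rewrite subsetT.
have := sum_prod_minority dis allT cs; rewrite cardsT.
set bad := [set c | _]; set q := size Ss => h.
have hb : (#|bad| * 2 ^ (m * q) <= 2 ^ (t * q) *
     \sum_(c : {set T} | c \subset [set: T]) \prod_(S <- Ss) 2 ^ minority c S)%N.
  rewrite -sum_nat_const big_distrr /=.
  rewrite [leqRHS](bigID (fun c => c \in bad)) /=.
  apply: leq_trans (leq_addr _ _).
  rewrite [leqRHS](eq_bigl (fun c => c \in bad)); last by move=> c; rewrite subsetT.
  apply: leq_sum => c; rewrite inE => cb.
  rewrite -(big_morph (expn 2) (expnD 2) (expn0 2)) -expnD leq_pexp2l // addnC.
  by [].
have pos : (0 < 2 ^ (m * q) * 2 ^ (t * q) * 4 ^ (m * q) * ('C(m.*2, m)) ^ q)%N.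
  by rewrite !muln_gt0 !expn_gt0 /= bin_gt0 -addnn leq_addr.
(* The [.+3] in the hypothesis is a factor 8 = 4 * 2 per set: 4 cancels the constant of
   [sum_pow_minority], and 2 is the gain in the conclusion. *)
have hm' p : ('C(m.*2, m) ^ p * (8 ^ p * 2 ^ (t * p)) <= 4 ^ (m * p))%N.
  case: p => [|p]; first by rewrite !muln0.
  by rewrite !(expnM _ _ p.+1) -!expnMn leq_exp2r //; apply: leq_trans hm;
    rewrite -(addn3 t) expnD [(8 * _)%N]mulnC.
move: hb h (hm' q) pos; rewrite !expnMn -!expnM.
set M := bigop.body _ _ _; set C := (_ ^ q)%N; set Z := (2 ^ #|T|)%N.
have -> : (8 ^ q = 4 ^ q * 2 ^ q)%N by rewrite -expnMn.
set a := (2 ^ (m * q))%N; set b := (2 ^ (t * q))%N; set c := (4 ^ (m * q))%N.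
set x := (4 ^ q)%N; set y := (2 ^ q)%N; set B := #|bad|.
move=> h1 h2 h3; rewrite !muln_gt0 -!andbA => /and4P[a0 b0 c0 C0].
rewrite -(leq_pmul2r (_ : 0 < a * c)%N) ?muln_gt0 ?a0 //.
have e1 := leq_mul (leqnn (y * c)%N) h1.
have e2 := leq_mul (leqnn (b * y)%N) h2.
have e3 := leq_mul (leqnn (Z * a)%N) h3.
by clear -e1 e2 e3; nia.
Qed.

(** Balance constrains only the part inside [S], so the count is C(2h,h) times a power of 2, and
    [central_bin_lower] applies. *)
Lemma card_balanced S h : (0 < h)%N -> #|S| = h.*2 ->
  (2 ^ #|T| <= h.*2 * #|[set c : {set T} | #|c :&: S| == h]|)%N.
Proof.
move=> h0 Sh.
have -> : #|[set c : {set T} | #|c :&: S| == h]| = ('C(h.*2, h) * 2 ^ #|~: S|)%N.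
  have := sum_subset_split (fun a : {set T} => nat_of_bool (#|a| == h)) (fun=> 1%N) (subsetT S).
  rewrite setTD sum1_card.
  have -> : #|(fun b : {set T} => b \subset ~: S)| = (2 ^ #|~: S|)%N.
    by rewrite -card_powerset; apply: eq_card => c; rewrite powersetE.
  have -> : (\sum_(a : {set T} | a \subset S) (#|a| == h) = 'C(h.*2, h))%N.
    rewrite -Sh -cards_draws -sum1_card -big_mkcondr /=.
    by apply: eq_bigl => a; rewrite inE.
  move=> <-; rewrite -sum1_card big_mkcond [RHS]big_mkcond /=.
  by apply: eq_bigr => c _; rewrite inE subsetT muln1; case: eqP.
rewrite -(cardsC S) expnD mulnA Sh leq_mul2r; apply/orP; right.
by have := central_bin_lower h0; rewrite -!mul2n (expnM 2 2).
Qed.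
End Colourings.

Local Open Scope ring_scope.

(** * Rank of two-variable functions *)

(** Rank as the length of a decomposition into products, for arbitrary index types. With any finite
    type [K] as summation index, adding and multiplying functions becomes adding and multiplying
    index types. *)
Definition rank_le (F : fieldType) (I J : Type) (Phi : I -> J -> F) (r : nat) : Prop :=
  exists (K : finType) (a : K -> I -> F) (b : K -> J -> F),
    (#|K| <= r)%N /\ forall i j, Phi i j = \sum_k a k i * b k j.

Section RankLe.
Variables (F : fieldType) (I J : Type).
Implicit Types (Phi Psi : I -> J -> F).

Lemma rank_le_leq Phi r r' : (r <= r')%N -> rank_le Phi r -> rank_le Phi r'.
Proof. by move=> rr' [K [a [b [Kr e]]]]; exists K, a, b; rewrite (leq_trans Kr). Qed.

Lemma rank_le_ext Phi Psi r : (forall i j, Phi i j = Psi i j) -> rank_le Phi r -> rank_le Psi r.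
Proof. by move=> e [K [a [b [Kr eq]]]]; exists K, a, b; split=> // i j; rewrite -e. Qed.

Lemma rank_le_prod (a : I -> F) (b : J -> F) : rank_le (fun i j => a i * b j) 1.
Proof.
by exists unit, (fun=> a), (fun=> b); rewrite card_unit; split=> // i j; rewrite big_const card_unit /= addr0.
Qed.

Lemma rank_le0 : rank_le (fun (i : I) (j : J) => 0 : F) 0.
Proof.
exists void, (fun _ _ => 0), (fun _ _ => 0); rewrite card_void; split=> // i j.
by rewrite big1 // => -[].
Qed.

Lemma rank_le_add Phi Psi r s : rank_le Phi r -> rank_le Psi s ->
  rank_le (fun i j => Phi i j + Psi i j) (r + s).
Proof.
move=> [K [a [b [Kr e]]]] [L [a' [b' [Ls e']]]].
exists (K + L)%type, (fun k => match k with inl k => a k | inr k => a' k end),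
  (fun k => match k with inl k => b k | inr k => b' k end).
rewrite card_sum leq_add //; split=> // i j.
by rewrite e e' big_sumType.
Qed.

Lemma rank_le_mul Phi Psi r s : rank_le Phi r -> rank_le Psi s ->
  rank_le (fun i j => Phi i j * Psi i j) (r * s).
Proof.
move=> [K [a [b [Kr e]]]] [L [a' [b' [Ls e']]]].
exists (K * L)%type, (fun k i => a k.1 i * a' k.2 i), (fun k i => b k.1 i * b' k.2 i).
rewrite card_prod leq_mul //; split=> // i j.
rewrite e e' big_distrlr pair_big /=; apply: eq_bigr => k _.
by rewrite mulrACA.
Qed.

Lemma rank_le_sum (T : Type) (s : seq T) (P : pred T) (Phi : T -> I -> J -> F) (r : T -> nat) :
  (forall t, P t -> rank_le (Phi t) (r t)) ->
  rank_le (fun i j => \sum_(t <- s | P t) Phi t i j) (\sum_(t <- s | P t) r t)%N.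
Proof.
move=> h; elim: s => [|t s IH].
  rewrite big_nil; apply: rank_le_ext rank_le0 => i j; by rewrite big_nil.
rewrite big_cons; case: ifP => Pt; last first.
  by apply: rank_le_ext IH => i j; rewrite big_cons Pt.
apply: rank_le_ext (rank_le_add (h t Pt) IH) => i j; by rewrite big_cons Pt.
Qed.
End RankLe.

Lemma rank_le_tr (F : fieldType) (I J : Type) (Phi : I -> J -> F) r :
  rank_le Phi r -> rank_le (fun j i => Phi i j) r.
Proof.
move=> [K [a [b [Kr e]]]]; exists K, b, a; split=> // i j.
by rewrite e; apply: eq_bigr => k _; rewrite mulrC.
Qed.

(** There are no more distinct rows than values of [kappa]. *)
Lemma rank_le_factor (F : fieldType) (I : finType) (J : Type) (K : finType)
    (kappa : I -> K) (Phi : I -> J -> F) :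
  (forall i i' j, kappa i = kappa i' -> Phi i j = Phi i' j) -> rank_le Phi #|K|.
Proof.
(* The indicator of a class times the row of a representative; a class without members gets the row
   0, which no [i] selects. *)
move=> h; exists K, (fun k i => (kappa i == k)%:R),
  (fun k j => if [pick i | kappa i == k] is Some i then Phi i j else 0).
split=> // i j; rewrite (bigD1 (kappa i)) //= eqxx mul1r big1 ?addr0.
  by case: pickP => [i' /eqP/h|/(_ i)]; rewrite ?eqxx.
by move=> k /negPf kN; rewrite eq_sym kN mul0r.
Qed.

(** After scaling by [a^-1], a decomposition over [K] factors the identity matrix of size [#|I|]
    through dimension [#|K|]. *)
Lemma rank_le_diag (F : fieldType) (I : finType) (a : F) (r : nat) : a != 0 ->
  rank_le (fun i j : I => a * (i == j)%:R) r -> (#|I| <= r)%N.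
Proof.
move=> a0 [K [b [c [Kr e]]]]; apply: leq_trans Kr.
pose B : 'M[F]_(#|I|, #|K|) := \matrix_(i, k) (a^-1 * b (enum_val k) (enum_val i)).
pose C : 'M[F]_(#|K|, #|I|) := \matrix_(k, j) c (enum_val k) (enum_val j).
apply: (@mulmx1_min F _ _ B C); apply/matrixP => i j; rewrite !mxE.
transitivity (a^-1 * (a * (enum_val i == enum_val j)%:R)).
  rewrite e big_distrr /= (reindex _ (onW_bij _ (enum_val_bij K))) /=.
  by apply: eq_bigr => k _; rewrite !mxE mulrA.
by rewrite mulKf // (inj_eq enum_val_inj).
Qed.

(** * Powers of layered transition matrices *)

Section MxPow.
Variables (R : pzRingType) (s : nat).
Implicit Type M : 'M[R]_s.

Lemma mxpow0 M : mxpow M 0 = 1%:M. Proof. by []. Qed.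
Lemma mxpowSr M k : mxpow M k.+1 = mxpow M k *m M. Proof. by []. Qed.
Lemma mxpowD M a b : mxpow M (a + b) = mxpow M a *m mxpow M b.
Proof.
elim: b => [|b IH]; first by rewrite addn0 mxpow0 mulmx1.
by rewrite addnS !mxpowSr IH mulmxA.
Qed.
End MxPow.

Lemma map_mxpow (R S : pzRingType) (f : {rmorphism R -> S}) s (M : 'M[R]_s) k :
  map_mx f (mxpow M k) = mxpow (map_mx f M) k.
Proof.
elim: k => [|k IH]; first by rewrite !mxpow0 map_mx1.
by rewrite !mxpowSr map_mxM IH.
Qed.

Section Layered.
Variables (R : pzRingType) (s : nat) (lay : 'I_s -> nat).

Lemma mxpow_layer (M : 'M[R]_s) :
  (forall u v, M u v = 0 \/ lay v = (lay u).+1) ->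
  forall k u v, mxpow M k u v = 0 \/ lay v = (lay u + k)%N.
Proof.
move=> hM; elim=> [|k IH] u v.
  by rewrite mxpow0 mxE; case: eqP => [->|_]; [right; rewrite addn0 | left].
rewrite mxpowSr mxE.
case: (lay v =P (lay u + k.+1)%N) => [|ne]; [by right | left].
apply: big1 => z _; case: (IH u z) => [->|ez]; first by rewrite mul0r.
case: (hM z v) => [->|ev]; first by rewrite mulr0.
by case: ne; rewrite ev ez addnS.
Qed.

(** A path of length [a] from [u] only leaves vertices in layers [lay u] to [lay u + a - 1], so all
    other rows are irrelevant. *)
Lemma mxpow_local (M M' : 'M[R]_s) a :
  (forall u v, M u v = 0 \/ lay v = (lay u).+1) ->
  forall u, (forall v z, (lay u <= lay v < lay u + a)%N -> M v z = M' v z) ->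
  forall z, mxpow M a u z = mxpow M' a u z.
Proof.
move=> hM u; elim: a => [|a IH] h z; first by rewrite !mxpow0.
rewrite !mxpowSr !mxE; apply: eq_bigr => v _.
rewrite -IH; last first.
  by move=> v' z' /andP[h1 h2]; apply: h; rewrite h1 addnS ltnS ltnW.
case: (mxpow_layer hM a u v) => [->|ev]; first by rewrite !mul0r.
by rewrite (h v z) // ev leq_addr addnS ltnSn.
Qed.
End Layered.

(** * Rank of an ordered set-multilinear program *)

(** The blocks read on the way from layer [p] to layer [p + a] by a program ordered by [sigma]. *)
Definition window (d : nat) (sigma : 'S_d) (p a : nat) : {set 'I_d} :=
  [set sigma l | l in [set l : 'I_d | p <= l < p + a]%N].

(** The list [s] gives the lengths of consecutive windows from position [p]; blocks outside [XY] are
    dropped because they will be frozen. *)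
Fixpoint windows (d : nat) (sigma : 'S_d) (XY : {set 'I_d}) (p : nat) (s : seq nat) :
    seq {set 'I_d} :=
  if s is a :: s' then (window sigma p a :&: XY) :: windows sigma XY (p + a) s' else [::].

Lemma mem_window d (sigma : 'S_d) p a (l : 'I_d) :
  (sigma l \in window sigma p a) = (p <= l < p + a)%N.
Proof. by rewrite /window mem_imset ?inE //; apply: perm_inj. Qed.

Section SmRank.
Variables (F : fieldType) (m d n h : nat) (blk : 'I_m -> 'I_d) (ind : 'I_m -> 'I_n).
Variable A : smABP F blk.

Definition sm_matrix (e : 'I_m -> F) : 'M[F]_(sm_s A) :=
  \matrix_(u, v) (sm_lab u v).@[e].

Lemma sm_poly_eval e : (sm_poly A).@[e] = mxpow (sm_matrix e) d (sm_src A) (sm_snk A).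
Proof.
have -> : sm_matrix e = map_mx (meval e) (\matrix_(u, v) sm_lab u v : 'M_(sm_s A)).
  by apply/matrixP => u v; rewrite !mxE.
by rewrite -map_mxpow mxE.
Qed.

Lemma sm_matrix_layer e u v :
  sm_matrix e u v = 0 \/ sm_lay v = (sm_lay u).+1 :> nat.
Proof.
rewrite mxE; case: (sm_edges u v) => [->|[l [-> -> _]]]; last by right.
by left; rewrite meval0.
Qed.

Lemma sm_matrix_local e e' u v :
  (forall l : 'I_d, sm_lay u = l :> nat ->
     forall j, blk j = sm_sigma A l -> e j = e' j) ->
  sm_matrix e u v = sm_matrix e' u v.
Proof.
move=> h1; rewrite !mxE; case: (sm_edges u v) => [->|[l [lu _ [a ->]]]].
  by rewrite !meval0.
rewrite !raddf_sum; apply: eq_bigr => j /eqP jl.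
by rewrite /= !mevalZ !mevalXU (h1 l).
Qed.

(* [f] supplies the coordinates of the blocks in [c], [f'] those of the other
   blocks of [XY]; the remaining blocks are frozen at [g0]. *)
Variables (XY c : {set 'I_d}) (rho : 'I_d -> 'I_h) (g0 : 'I_d -> 'I_n).

Definition glue (f f' : {ffun 'I_h -> 'I_n}) (b : 'I_d) : 'I_n :=
  if b \in XY then if b \in c then f (rho b) else f' (rho b) else g0 b.

(** When [ind] separates the variables of each block, the value of a set-multilinear polynomial at
    this 0/1 point is the coefficient of the monomial picking variable [g b] in every block [b].
    Evaluations thus replace the coefficient matrix. *)
Definition unit_point (g : 'I_d -> 'I_n) (j : 'I_m) : F := (g (blk j) == ind j)%:R.

(** Between these layers only window blocks are read, so the entry depends on [f] through the window
    blocks in [c] and on [f'] through those outside. Sorting rows by the former or columns by the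
    latter gives the two sides of the minimum. *)
Lemma rank_window u z a :
  rank_le (fun f f' => mxpow (sm_matrix (unit_point (glue f f'))) a u z)
    (n ^ minority c (window (sm_sigma A) (sm_lay u) a :&: XY)).
Proof.
set W := window _ _ _.
have loc (f1 f1' f2 f2' : {ffun 'I_h -> 'I_n}) : (forall b, b \in W :&: XY -> b \in c -> f1 (rho b) = f2 (rho b)) ->
   (forall b, b \in W :&: XY -> b \notin c -> f1' (rho b) = f2' (rho b)) ->
   mxpow (sm_matrix (unit_point (glue f1 f1'))) a u z =
   mxpow (sm_matrix (unit_point (glue f2 f2'))) a u z.
  move=> h1 h2; apply: (mxpow_local (lay := fun u => sm_lay u)).
    exact: sm_matrix_layer.
  move=> v z' hv; apply: sm_matrix_local => l lv j bj.
  rewrite /unit_point; suff -> : glue f1 f1' (blk j) = glue f2 f2' (blk j) by [].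
  have bW : blk j \in W by rewrite bj mem_window -lv.
  rewrite /glue; case: ifP => // bXY.
  by case: ifP => bc; [apply: h1 | apply: h2]; rewrite ?inE ?bW ?bXY ?bc.
rewrite /minority; set R := _ :&: (_ :&: _); set C := _ :\: c.
have factor (S : {set 'I_d}) : exists kappa : {ffun 'I_h -> 'I_n} -> (size (enum S)).-tuple 'I_n,
    forall f f', kappa f = kappa f' -> forall b, b \in S -> f (rho b) = f' (rho b).
  exists (fun f => [tuple of map (fun b => f (rho b)) (in_tuple (enum S))]) => f f' /(congr1 val) /= e b bS.
  by move/eq_in_map: e; apply; rewrite mem_enum.
have cardS (S : {set 'I_d}) : #|{: (size (enum S)).-tuple 'I_n}| = (n ^ #|S|)%N.
  by rewrite card_tuple card_ord -cardE.
have hR : rank_le (fun f f' => mxpow (sm_matrix (unit_point (glue f f'))) a u z) (n ^ #|R|).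
  have [kappa hk] := factor R; rewrite -cardS; apply: (rank_le_factor (kappa := kappa)).
  move=> f1 f2 f' /hk e; apply: loc => // b bW bc; apply: e.
  by rewrite inE bc.
have hC : rank_le (fun f f' => mxpow (sm_matrix (unit_point (glue f f'))) a u z) (n ^ #|C|).
  have [kappa hk] := factor C; rewrite -cardS; apply: rank_le_tr.
  apply: (rank_le_factor (kappa := kappa)).
  move=> f1 f2 f' /hk e; apply: loc => // b bW bc; apply: e.
  by rewrite inE bc.
by rewrite /minn; case: ifP.
Qed.

(** Every path crosses the layer ending the first window in one of at most [sm_width A] nodes. For a
    fixed node the two halves of the path sum multiply, and so do their ranks. *)
Lemma rank_windows (s : seq nat) u : (sm_lay u + sumn s = d)%N ->
  rank_le (fun f f' => mxpow (sm_matrix (unit_point (glue f f'))) (sumn s) u (sm_snk A))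
    (sm_width A ^ size s * n ^ (\sum_(S <- windows (sm_sigma A) XY (sm_lay u) s) minority c S)).
Proof.
elim: s u => [|a s IH] u /= ud.
  rewrite big_nil !expn0 muln1; apply: rank_le_ext (rank_le_prod (fun=> 1) (fun=> (u == sm_snk A)%:R)) => f f'.
  by rewrite /= mxE mul1r.
rewrite big_cons.
pose Q := [set z : 'I_(sm_s A) | sm_lay z == (sm_lay u + a)%N :> nat].
set B := (\sum_(S <- _) _)%N; set r := minority _ _.
have Qw : (#|Q| <= sm_width A)%N.
  rewrite /sm_width /Q.
  have hl : (sm_lay u + a < d.+1)%N by lia.
  apply: leq_trans (leq_bigmax (Ordinal hl)).
  by apply: eq_leq; apply: eq_card => z; rewrite !inE.
apply: (@rank_le_leq _ _ _ _ (\sum_(z in Q) n ^ r * (sm_width A ^ size s * n ^ B))).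
  by rewrite sum_nat_const expnD expnS -mulnA [(_ ^ _ * (n ^ r * _))%N]mulnCA leq_mul2r Qw orbT.
apply: (rank_le_ext (Phi := fun f f' => \sum_(z in Q)
   mxpow (sm_matrix (unit_point (glue f f'))) a u z *
   mxpow (sm_matrix (unit_point (glue f f'))) (sumn s) z (sm_snk A))).
  move=> f f'; rewrite mxpowD mxE big_mkcond /=; apply: eq_bigr => z _.
  rewrite inE; case: eqP => // ne.
  case: (mxpow_layer (lay := fun u => sm_lay u) (@sm_matrix_layer (unit_point (glue f f'))) a u z) => [->|//].
  by rewrite mul0r.
apply: rank_le_sum => z; rewrite inE => /eqP zl.
apply: rank_le_mul; first exact: rank_window.
by rewrite /B -zl; apply: IH; rewrite zl; lia.
Qed.

Lemma rank_sm_poly (s : seq nat) : sumn s = d ->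
  rank_le (fun f f' => (sm_poly A).@[unit_point (glue f f')])
    (sm_width A ^ size s * n ^ (\sum_(S <- windows (sm_sigma A) XY 0 s) minority c S)).
Proof.
move=> sd.
have l0 : sm_lay (sm_src A) = 0%N :> nat by rewrite (sm_first _).2.
have := @rank_windows s (sm_src A); rewrite l0 sd => /(_ erefl).
by apply: rank_le_ext => f f'; rewrite sm_poly_eval.
Qed.
End SmRank.

(** * Cutting the block order into windows *)

Lemma card_window_add d (sigma : 'S_d) XY p a b :
  #|window sigma p (a + b) :&: XY| =
  (#|window sigma p a :&: XY| + #|window sigma (p + a) b :&: XY|)%N.
Proof.
have cntE q c : #|window sigma q c :&: XY| = (\sum_(l < d) (q <= l < q + c) && (sigma l \in XY))%N.
  rewrite -sum1_card big_mkcond (reindex_inj (@perm_inj _ sigma)) /=.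
  by apply: eq_bigr => l _; rewrite inE mem_window; case: andP.
rewrite !cntE -big_split /=; apply: eq_bigr => l _.
by case: (_ \in _); rewrite ?andbF // !andbT; lia.
Qed.

Lemma windows_disjoint d (sigma : 'S_d) XY p s :
  pairwise (fun S S' : {set 'I_d} => [disjoint S & S']) (windows sigma XY p s).
Proof.
elim: s p => //= a s IH p; rewrite IH andbT {IH}.
have := leqnn (p + a); elim: s {2 3}(p + a)%N => //= b s IH' q hq.
apply/andP; split; last by apply: IH'; apply: leq_trans hq (leq_addr _ _).
rewrite -setI_eq0; apply/eqP/setP => x; rewrite !inE.
have := mem_window sigma p a ((sigma^-1)%g x); have := mem_window sigma q b ((sigma^-1)%g x).
rewrite permKV => -> ->; lia.
Qed.

(** Greedy cutting: [q] times the shortest window holding [m] blocks of [XY] is taken, and [R]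
    collects the rest. *)
Lemma exists_windows d (sigma : 'S_d) XY m q p : (p <= d)%N ->
  (m * q <= #|window sigma p (d - p) :&: XY|)%N ->
  exists s Ss R, [/\ (p + sumn s = d)%N, windows sigma XY p s = rcons Ss R,
    size Ss = q, all (fun S : {set 'I_d} => #|S| == m) Ss &
    #|R| = (#|window sigma p (d - p) :&: XY| - m * q)%N].
Proof.
elim: q p => [|q IH] p pd hq.
  exists [:: (d - p)%N], [::], (window sigma p (d - p) :&: XY).
  by split=> //=; lia.
have cnt0 : #|window sigma p 0 :&: XY| = 0%N.
  apply/eqP; rewrite cards_eq0; apply/eqP/setP => x; rewrite !inE.
  by have := mem_window sigma p 0 ((sigma^-1)%g x); rewrite permKV => ->; lia.
have cnt1 b : (#|window sigma b 1 :&: XY| <= 1)%N.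
  apply/card_le1_eqP => x y; rewrite !inE => /andP[+ _] /andP[+ _].
  have := mem_window sigma b 1 ((sigma^-1)%g x); have := mem_window sigma b 1 ((sigma^-1)%g y).
  rewrite !permKV => -> -> hx hy.
  by apply: (@perm_inj _ (sigma^-1)%g); apply: val_inj => /=; lia.
have hex : exists a, (m <= #|window sigma p a :&: XY|)%N by exists (d - p)%N; nia.
case: (ex_minnP hex) => {hex}a ha amin.
(* A window one position shorter has fewer than [m] blocks, and one position adds at most one, so
   the minimal window has exactly [m]. *)
have ea : #|window sigma p a :&: XY| = m.
  case: a ha amin => [|a] ha amin; first by lia.
  have := cnt1 (p + a)%N; have := card_window_add sigma XY p a 1; rewrite addn1.
  case: (leqP m #|window sigma p a :&: XY|) => [/amin|]; lia.
have ad : (a <= d - p)%N by apply: amin; nia.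
have eD := card_window_add sigma XY p a (d - p - a); rewrite subnKC // ea in eD.
have ed : (d - (p + a) = d - p - a)%N by lia.
have [||s [Ss [R [h1 h2 h3 h4 h5]]]] := IH (p + a)%N; [by lia|by rewrite ed; nia|].
exists (a :: s), ((window sigma p a :&: XY) :: Ss), R; split=> /=.
- by rewrite addnA.
- by rewrite h2.
- by rewrite h3.
- by rewrite ea eqxx.
- by rewrite h5 ed eD; nia.
Qed.

Lemma size_windows d (sigma : 'S_d) XY p s : size (windows sigma XY p s) = size s.
Proof. by elim: s p => //= a s IH p; rewrite IH. Qed.

Lemma pairwise_rcons_l (T : Type) (r : rel T) s x : pairwise r (rcons s x) -> pairwise r s.
Proof. by rewrite pairwise_rcons => /andP[]. Qed.

(** * Low rank of narrow programs against full rank *)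

Section Tradeoff.
Variables (F : fieldType) (m d n h : nat) (blk : 'I_m -> 'I_d) (ind : 'I_m -> 'I_n).
Variables (XY : {set 'I_d}) (k M : nat).
Hypothesis n1 : (1 < n)%N.
Hypothesis cardXY : #|XY| = h.*2.
Hypothesis M0 : (0 < M)%N.
Hypothesis Mlarge : ('C(M.*2, M) * 2 ^ (k.*2.+1).+3 <= 4 ^ M)%N.
Let q := (h %/ M)%N.
Hypothesis q0 : (0 < q)%N.

(** With t = 2k+1, [bad] holds the colourings whose minorities over the [q] full windows sum to at
    least (M-t)q. For the others the missing tq pays for the widths, n^(k(q+1)), and for the gain
    n^q, since k(q+1) + q <= (2k+1)q when q >= 1. *)
Lemma smABP_low_rank (A : smABP F blk) : (sm_width A <= n ^ k)%N ->
  exists bad : {set {set 'I_d}}, (#|bad| * 2 ^ q <= 2 ^ d)%N /\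
    forall c rho g0, c \notin bad -> exists r, (r * n ^ q <= n ^ h)%N /\
      rank_le (fun f f' : {ffun 'I_h -> 'I_n} =>
        (sm_poly A).@[unit_point F blk ind (glue XY c rho g0 f f')]) r.
Proof.
move=> wA.
have whole : window (sm_sigma A) 0 (d - 0) :&: XY = XY.
  apply/setP => x; rewrite inE.
  have := mem_window (sm_sigma A) 0 (d - 0) (((sm_sigma A)^-1)%g x).
  by rewrite permKV => ->; rewrite subn0 add0n ltn_ord.
have hq : (M * q <= h)%N by rewrite mulnC leq_divM.
have [|s [Ss [R []]]] := @exists_windows d (sm_sigma A) XY M.*2 q 0 (leq0n d).
  by rewrite whole cardXY; lia.
rewrite whole cardXY add0n => sd sw Sq Sm Rc.
have dis := windows_disjoint (sm_sigma A) XY 0 s; rewrite sw in dis.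
have hbad := card_high_minority Mlarge (pairwise_rcons_l dis) Sm.
rewrite Sq card_ord in hbad.
eexists; split; first exact: hbad.
move=> c rho g0; rewrite inE -ltnNge => good.
have hr := rank_sm_poly ind A XY c rho g0 sd.
eexists; split; last exact: hr.
rewrite sw big_rcons /= -(size_windows (sm_sigma A) XY 0) sw size_rcons Sq.
(* The last window has 2h - 2Mq blocks, hence a minority of at most h - Mq. *)
have Rh := minority_half c R; rewrite Rc in Rh.
apply: (@leq_trans (n ^ (k * q.+1) * n ^ (\sum_(S <- Ss) minority c S + minority c R) * n ^ q)%N).
  by rewrite expnM; do 2!apply: leq_mul => //; case: (q.+1) (ltn0Sn q) => // p _; rewrite leq_exp2r.
rewrite -!expnD leq_pexp2l //; first exact: ltnW.
move: good Rh; set x := (\sum_(_ <- _) _)%N; set y := minority _ _; nia.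
Qed.

(** A union bound over the bad sets, together with subadditivity of rank. *)
Lemma sum_smABP_low_rank (As : seq (smABP F blk)) : (max_width As <= n ^ k)%N ->
  exists bad : {set {set 'I_d}}, (#|bad| * 2 ^ q <= size As * 2 ^ d)%N /\
    forall c rho g0, c \notin bad -> exists r, (r * n ^ q <= size As * n ^ h)%N /\
      rank_le (fun f f' : {ffun 'I_h -> 'I_n} =>
        (sum_poly As).@[unit_point F blk ind (glue XY c rho g0 f f')]) r.
Proof.
elim: As => [_|A As IH].
  exists set0; rewrite cards0; split=> // c rho g0 _; exists 0%N; split=> //.
  by apply: rank_le_ext (@rank_le0 F _ _) => f f'; rewrite /sum_poly big_nil meval0.
rewrite /max_width big_cons geq_max => /andP[/smABP_low_rank[b1 [c1 h1]] /IH[b2 [c2 h2]]].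
exists (b1 :|: b2); split.
  rewrite /= mulSn; apply: leq_trans (leq_add c1 c2).
  by rewrite -mulnDl leq_mul2r leq_card_setU orbT.
move=> c rho g0; rewrite inE negb_or => /andP[/(h1 _ rho g0)[r1 [e1 hr1]] /(h2 _ rho g0)[r2 [e2 hr2]]].
exists (r1 + r2)%N; split; first by rewrite /= mulSn mulnDl leq_add.
apply: rank_le_ext (rank_le_add hr1 hr2) => f f'.
by rewrite /sum_poly big_cons mevalD.
Qed.

Lemma sum_smABP_size (As : seq (smABP F blk)) : (max_width As <= n ^ k)%N ->
  (forall c : {set 'I_d}, #|c :&: XY| = h -> exists rho g0 a, a != 0 /\
     forall f f' : {ffun 'I_h -> 'I_n},
       (sum_poly As).@[unit_point F blk ind (glue XY c rho g0 f f')] = a * (f == f')%:R) ->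
  (2 ^ q <= h.*2 * size As)%N.
Proof.
move=> /sum_smABP_low_rank[bad [badc low]] full.
have h0 : (0 < h)%N by have := leq_div h M; rewrite -/q; lia.
have bal := card_balanced h0 cardXY; rewrite card_ord in bal.
(* If all balanced colourings are bad, counting them bounds [size As] from below. Otherwise a good
   balanced one has rank [n ^ h], which forces [n ^ q] programs. *)
have [/subset_leq_card sub|/subsetPn[c]] := boolP ([set c : {set 'I_d} | #|c :&: XY| == h] \subset bad).
  rewrite -(leq_pmul2l (_ : 0 < 2 ^ d)%N) ?expn_gt0 //.
  apply: (@leq_trans (h.*2 * (#|bad| * 2 ^ q))%N); last by rewrite [leqRHS]mulnC -mulnA leq_mul2l badc orbT.
  by rewrite mulnA leq_mul2r (leq_trans bal) ?orbT // leq_mul2l sub orbT.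
rewrite inE => /eqP /full [rho [g0 [a [a0 e]]]] /low -/(_ rho g0) [r [hr lr]].
have := rank_le_diag a0 (rank_le_ext e lr); rewrite card_ffun !card_ord => nr.
have : (n ^ q <= size As)%N.
  rewrite -(leq_pmul2l (_ : 0 < n ^ h)%N) ?expn_gt0 ?(ltnW n1) //.
  by rewrite [leqRHS]mulnC; apply: leq_trans hr; rewrite leq_mul2r nr orbT.
move=> hn; apply: (@leq_trans (n ^ q)%N); first by rewrite leq_exp2r.
by apply: leq_trans hn _; rewrite leq_pmull // double_gt0.
Qed.
End Tradeoff.

(** * Skew straight-line programs and the characteristic polynomial *)

Section CharPolyBlock.
Variables (R : idomainType) (k : nat) (a : R) (r : 'rV[R]_k) (c : 'cV[R]_k) (B : 'M[R]_k).

(** By Cramer's rule this is [char_poly B] times r (X - B)^-1, the row of the Schur complement freed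
    of denominators. *)
Definition adj_row : 'rV[{poly R}]_k := map_mx polyC r *m \adj (char_poly_mx B).

Lemma adj_row_mul : adj_row *m char_poly_mx B = char_poly B *: map_mx polyC r.
Proof. by rewrite /adj_row -mulmxA mul_adj_mx mul_mx_scalar. Qed.

(** Comparing coefficients of X^(i+1) in [adj_row_mul] gives a recurrence descending in [i], each
    product of which has an entry of [B] or [r] as a factor. *)
Lemma coef_adj_row u i :
  (adj_row 0 u)`_i = \sum_v (adj_row 0 v)`_i.+1 * B v u + (char_poly B)`_i.+1 * r 0 u.
Proof.
move: adj_row adj_row_mul => W /matrixP/(_ 0 u); rewrite !mxE => e.
have e1 : W 0 u * 'X = \sum_v W 0 v * (B v u)%:P + char_poly B * (r 0 u)%:P.
  rewrite -e -big_split /=.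
  under eq_bigr => v _ do rewrite !mxE -mulrDr [X in _ * X]addrC subrK.
  rewrite (bigD1 u) //= eqxx mulr1n big1 ?addr0 // => v /negPf vu.
  by rewrite vu mulr0n mulr0.
have := congr1 (fun p : {poly R} => p`_i.+1) e1.
rewrite coefMX /= => ->; rewrite coefD coefMC coef_sum; congr (_ + _).
by apply: eq_bigr => v _; rewrite coefMC.
Qed.

(** Descending induction from an index [b] beyond all degrees: for [i >= k] the term with
    [char_poly B], of degree [k], vanishes from the recurrence. *)
Lemma coef_adj_row_large u i : (k <= i)%N -> (adj_row 0 u)`_i = 0.
Proof.
pose b := (\max_(v < k) size (adj_row 0%R v))%N.
have big v j : (b <= j)%N -> (adj_row 0 v)`_j = 0.
  by move=> bj; apply: nth_default; apply: leq_trans bj; apply: (leq_bigmax v).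
suff h t v j : (k <= j)%N -> (b <= j + t)%N -> (adj_row 0 v)`_j = 0.
  by move=> ki; apply: (h b) => //; rewrite leq_addl.
elim: t v j => [|t IH] v j kj bj; first by apply: big; rewrite addn0 in bj.
rewrite coef_adj_row big1 => [|w _]; last by rewrite IH ?mul0r //; lia.
by rewrite nth_default ?mul0r ?addr0 // size_char_poly ltnS.
Qed.

(* Schur complement of the lower right block of [X - M]. *)
Lemma char_poly_block :
  char_poly (block_mx a%:M r c B) =
  ('X - a%:P) * char_poly B - (adj_row *m map_mx polyC c) 0 0.
Proof.
set N := char_poly_mx B; set D := char_poly B.
have D0 : D != 0 by rewrite monic_neq0 // char_poly_monic.
set Y := (adj_row *m _) 0 0.
apply: (mulIf D0).
have XE : char_poly_mx (block_mx a%:M r c B) =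
    block_mx ('X - a%:P)%:M (- map_mx polyC r) (- map_mx polyC c) N.
  rewrite /char_poly_mx map_block_mx scalar_mx_block opp_block_mx add_block_mx.
  by rewrite !add0r map_scalar_mx raddfB.
(* Elimination without fractions: scaling the first column by [D] lets [\adj N] clear the block
   below the corner. *)
pose Z : 'M[{poly R}]_(1 + k) := block_mx D%:M 0 (\adj N *m map_mx polyC c) 1%:M.
have := det_mulmx (char_poly_mx (block_mx a%:M r c B)) Z.
rewrite {2}/Z det_lblock det1 det_scalar1 mulr1 -/(char_poly _) => <-.
rewrite XE /Z mulmx_block !mulmx0 !mulmx1 !add0r.
have -> : - map_mx polyC c *m D%:M + N *m (\adj N *m map_mx polyC c) = 0.
  by rewrite mulmxA mul_mx_adj mul_mx_scalar mul_scalar_mx scalerN addNr.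
rewrite det_ublock -/N -[\det N]/D; congr (_ * _).
rewrite -scalar_mxM mulNmx mulmxA -/adj_row [_ *m map_mx _ c]mx11_scalar -/Y.
by rewrite -raddfB det_scalar1.
Qed.

Lemma coef_char_poly_block i :
  (char_poly (block_mx a%:M r c B))`_i =
  (if i is i'.+1 then (char_poly B)`_i' else 0) - a * (char_poly B)`_i -
  \sum_u (adj_row 0 u)`_i * c u 0.
Proof.
rewrite char_poly_block coefB mulrBl coefB coefXM coefCM; congr (_ - _ - _).
  by case: i.
rewrite mxE coef_sum; apply: eq_bigr => u _; by rewrite [map_mx polyC c u 0]mxE coefMC.
Qed.
End CharPolyBlock.

(** * Cost calculus for skew straight-line programs *)

Section StraightLine.
Variables (F : fieldType) (m : nat).
Local Notation R := {mpoly F[m]}.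
Implicit Types (p q a : R) (s : seq R) (S Q : R -> Prop).

Definition affine p := (msize p <= 2)%N.

(* The affine factor in every product is what lets such a program unfold into
   a branching program of polynomial size. *)
Inductive slp : seq R -> Prop :=
| slp_one : slp [:: 1]
| slp_mul s a p : slp s -> affine a -> p \in s -> slp (rcons s (a * p))
| slp_add s p q : slp s -> p \in s -> q \in s -> slp (rcons s (p + q)).

Lemma affine0 : affine 0. Proof. by rewrite /affine msize0. Qed.
Lemma affine1 : affine 1. Proof. by rewrite /affine msize1. Qed.
Lemma affineN a : affine a -> affine (- a). Proof. by rewrite /affine msizeN. Qed.
Lemma affineD a b : affine a -> affine b -> affine (a + b).
Proof. by rewrite /affine => ha hb; apply: leq_trans (msizeD_le _ _) _; rewrite geq_max ha. Qed.
Lemma affineX i : affine 'X_i. Proof. by rewrite /affine msizeX mdeg1. Qed.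
Lemma affine_nat (b : bool) : affine b%:R.
Proof. by case: b; [apply: affine1 | apply: affine0]. Qed.
Lemma affine_sum (I : Type) (r : seq I) (P : pred I) (f : I -> R) :
  (forall i, P i -> affine (f i)) -> affine (\sum_(i <- r | P i) f i).
Proof. by move=> h; elim/big_ind: _ => // *; [apply: affine0 | apply: affineD]. Qed.

Lemma slp_mem1 s : slp s -> 1 \in s.
Proof.
by elim => [|s' a p _ IH _ _|s' p q _ IH _ _]; rewrite ?inE // mem_rcons inE IH orbT.
Qed.

Definition computable (c : nat) S :=
  exists s, [/\ slp s, (size s <= c)%N & forall p, S p -> p \in s].

(** At most [k] further instructions yield [Q] from any program computing at least [S]. Quantifying
    over [S'] keeps earlier results at hand, so the costs of successive stages add up. *)
Definition extends (k : nat) S Q := forall c S', (forall p, S p -> S' p) ->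
  computable c S' -> computable (c + k) (fun p => S' p \/ Q p).

Lemma extends_weaken k k' S S2 Q Q2 : (k <= k')%N -> (forall p, S p -> S2 p) ->
  (forall p, Q2 p -> Q p) -> extends k S Q -> extends k' S2 Q2.
Proof.
move=> kk SS QQ h c S' h1 h2; have [|s [hs sz mem]] := h c S' _ h2.
  by move=> p /SS/h1.
exists s; split=> //; first by apply: leq_trans sz _; rewrite leq_add2l.
by move=> p [Sp|/QQ Qp]; apply: mem; [left|right].
Qed.

Lemma extends_refl S Q : (forall p, Q p -> S p) -> extends 0 S Q.
Proof.
move=> QS c S' SS [s [hs sz mem]]; exists s; rewrite addn0; split=> // p.
by case=> [|/QS/SS]; apply: mem.
Qed.

Lemma extends_trans k l S Q Q' : extends k S Q -> extends l (fun p => S p \/ Q p) Q' ->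
  extends (k + l) S (fun p => Q p \/ Q' p).
Proof.
move=> h1 h2 c S' SS /(h1 _ _ SS) /h2 [|s [hs sz mem]].
  by move=> p [/SS|]; [left|right].
exists s; rewrite addnA; split=> // p h; apply: mem; tauto.
Qed.

Lemma extends_mul a p S : affine a -> S p -> extends 1 S (eq (a * p)).
Proof.
move=> ha Sp c S' SS [s [hs sz mem]]; exists (rcons s (a * p)); split.
- by apply: slp_mul => //; apply/mem/SS.
- by rewrite size_rcons addn1.
- by move=> q [/mem|<-]; rewrite mem_rcons inE ?eqxx // => ->; rewrite orbT.
Qed.

Lemma extends_add p q S : S p -> S q -> extends 1 S (eq (p + q)).
Proof.
move=> Sp Sq c S' SS [s [hs sz mem]]; exists (rcons s (p + q)); split.
- by apply: slp_add => //; apply/mem/SS.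
- by rewrite size_rcons addn1.
- by move=> r [/mem|<-]; rewrite mem_rcons inE ?eqxx // => ->; rewrite orbT.
Qed.

Lemma extends1 S : extends 0 S (eq 1).
Proof.
move=> c S' SS [s [hs sz mem]]; exists s; rewrite addn0; split=> // p.
by case=> [/mem //|<-]; apply: slp_mem1.
Qed.

Lemma extends0 S : extends 1 S (eq 0).
Proof.
have := extends_trans (@extends1 S) (extends_mul affine0 (or_intror (erefl (1 : R)))).
by apply: extends_weaken => // p <-; right; rewrite mul0r.
Qed.

Lemma extends_comp k l S p q : extends k S (eq p) ->
  extends l (fun r => S r \/ p = r) (eq q) -> extends (k + l) S (eq q).
Proof.
move=> h1 h2; apply: extends_weaken (extends_trans h1 h2) => // r; by right.
Qed.

Lemma extends_compD k l S p q : extends k S (eq p) -> extends l S (eq q) ->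
  extends (k + l).+1 S (eq (p + q)).
Proof.
move=> h1 h2; rewrite -addn1 -addnA; apply: (extends_comp h1).
apply: (@extends_comp _ _ _ q); first by apply: extends_weaken h2 => // r; left.
by apply: extends_add; [left; right | right].
Qed.

Lemma extends_compM k S a p : affine a -> extends k S (eq p) -> extends k.+1 S (eq (a * p)).
Proof.
move=> ha h1; rewrite -addn1; apply: (extends_comp h1).
by apply: extends_mul => //; right.
Qed.

Lemma extends_sum k S (T : finType) (f : T -> R) :
  (forall t, extends k S (eq (f t))) -> extends (#|T| * k.+1).+1 S (eq (\sum_t f t)).
Proof.
move=> h; rewrite cardT -big_enum /=; elim: (enum T) => [|t s IH].
  by rewrite big_nil; apply: extends0.
rewrite big_cons /=; apply: extends_weaken (extends_compD (h t) IH) => //.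
by rewrite mulSn; lia.
Qed.

Lemma extends_family k S (T : finType) (f : T -> R) :
  (forall t, extends k S (eq (f t))) ->
  extends (#|T| * k) S (fun p => exists t, p = f t).
Proof.
move=> h; have {h} : forall s : seq T,
    extends (size s * k) S (fun p => exists t, t \in s /\ p = f t).
  elim=> [|t s IH]; first by apply: extends_refl => p [t []].
  have h' : extends k (fun p => S p \/ exists t, t \in s /\ p = f t) (eq (f t)).
    by apply: extends_weaken (h t) => // p; left.
  apply: extends_weaken (extends_trans IH h') => // [|p [t' []]].
    by rewrite /= mulSn addnC.
  rewrite inE => /orP[/eqP -> ->|ts ->]; [by right | left; by exists t'].
move=> /(_ (enum T)); rewrite -cardT; apply: extends_weaken => // p [t ->].
by exists t; rewrite mem_enum.
Qed.
End StraightLine.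

(** * A skew program for the characteristic polynomial and the determinant *)

Section CharPolyProgram.
Variables (F : fieldType) (m : nat).
Local Notation R := {mpoly F[m]}.
Implicit Types (p q a : R) (s : seq R) (S Q : R -> Prop).

(** Matrix entries need not be affine; what is charged is the multiplication of an available [p] by
    the entry, carried out in skew instructions. *)
Definition mul_cost (kappa : nat) (x : R) :=
  forall S p, S p -> extends kappa S (eq (x * p)).

(** The cost of bordering by one row and column: first the coefficients of [adj_row], then those of
    the new characteristic polynomial. Each outer [+ 1] is the constant 0, used for coefficients
    beyond the degree. *)
Definition char_poly_cost (N kappa : nat) : nat :=
  ((N * (N * (N * kappa.+1 + kappa + 3)) + 1) + (N.+2 * (N * kappa.+1 + kappa + 10) + 1))%N.

(** Induction peeling off the first row and column: the coefficients for the lower right block give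
    those of [adj_row] from the top down, and then [coef_char_poly_block] applies. *)
Lemma extends_char_poly N kappa k (M : 'M[R]_k) S : (k <= N)%N ->
  (forall i j, mul_cost kappa (M i j)) ->
  extends (k * char_poly_cost N kappa).+1 S (fun p => exists i, p = (char_poly M)`_i).
Proof.
elim: k M S => [|k IH] M S kN hM.
  have -> : char_poly M = 1 by rewrite /char_poly det_mx00.
  apply: extends_weaken (extends_trans (@extends0 F m S) (@extends1 F m _)) => // p [i ->].
  by rewrite coef1; case: (i == 0)%N; [right | left].
have eM : M = block_mx (M 0 0)%:M (@ursubmx _ 1 k 1 k M) (@dlsubmx _ 1 k 1 k M) (@drsubmx _ 1 k 1 k M).
  suff -> : (M 0 0)%:M = @ulsubmx _ 1 k 1 k M by rewrite (@submxK _ 1 k 1 k M).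
  rewrite [RHS]mx11_scalar; congr (_%:M); rewrite !mxE; congr (M _ _); exact: val_inj.
set a := M 0 0 in eM; set r := ursubmx _ in eM; set c := dlsubmx _ in eM; set B := drsubmx _ in eM.
have hB i j : mul_cost kappa (B i j) by rewrite /B !mxE; apply: hM.
have hr j : mul_cost kappa (r 0 j) by rewrite /r !mxE; apply: hM.
have hc i : mul_cost kappa (c i 0) by rewrite /c !mxE; apply: hM.
have ha : mul_cost kappa a by apply: hM.
have {IH} hD := IH B S (ltnW kN) hB.
rewrite eM; set D := char_poly B in hD.
pose isD p := exists i, p = D`_i.
pose W := adj_row r B.
(* After [t] rounds of the descending recurrence all coefficients of index at least [k - t] are
   available; round 0 supplies only zeros. *)
pose isW t p := exists u i, (k <= i + t)%N /\ p = (W 0 u)`_i.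
have hW t S' : (forall p, isD p -> S' p) ->
    extends (t * (N * (N * kappa.+1 + kappa + 3)) + 1) S' (isW t).
  move=> DS; elim: t => [|t IHt].
    apply: extends_weaken (@extends0 F m S') => // p [u [i [ki ->]]].
    by rewrite coef_adj_row_large // -(addn0 i).
  have h u : extends (N * kappa.+1 + kappa + 3) (fun p => S' p \/ isW t p)
      (eq (W 0 u)`_(k - t.+1)).
    (* For [k <= t] the truncated index [k - t.+1] is 0, and that coefficient is already in
       [isW t]. *)
    rewrite coef_adj_row; case: (ltnP t k) => tk; last first.
      have -> : \sum_v (adj_row r B 0 v)`_(k - t.+1).+1 * B v u + D`_(k - t.+1).+1 * r 0 u =
        (W 0 u)`_(k - t.+1) by rewrite -coef_adj_row.
      apply: (@extends_weaken _ _ 0 _ (fun p => S' p \/ isW t p) _ (eq (W 0 u)`_(k - t.+1))) => //.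
      apply: extends_refl => p <-; right; exists u, (k - t.+1)%N; split=> //; lia.
    apply: (@extends_weaken _ _ ((#|'I_k| * kappa.+1).+1 + kappa).+1 _
              (fun p => S' p \/ isW t p) _ _ _ _ _ (fun p e => e)) => //.
      by rewrite card_ord; nia.
    apply: extends_compD.
      apply: extends_sum => v; rewrite mulrC; apply: hB; right; exists v, (k - t.+1).+1.
      by split=> //; lia.
    by rewrite mulrC; apply: hr; left; apply: DS; eexists.
  apply: extends_weaken (extends_trans IHt (extends_family h)) => //.
    by rewrite card_ord mulSn; nia.
  move=> p [u [i [ki ->]]]; case: (leqP k (i + t)) => h'; first by left; exists u, i.
  by right; exists u; congr (_`_ _); lia.
pose D' := char_poly (block_mx a%:M r c B).
have hD' S' i : (forall p, isD p -> S' p) -> (forall p, isW k p -> S' p) ->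
    extends (N * kappa.+1 + kappa + 10) S' (eq D'`_i).
  move=> DS WS; rewrite /D' coef_char_poly_block -/D.
  apply: (@extends_weaken _ _ ((1 + kappa.+1).+1 + ((#|'I_k| * kappa.+1).+1).+1).+1 _
            S' _ _ _ _ _ (fun p e => e)) => //.
    by rewrite card_ord; nia.
  apply: extends_compD.
    apply: extends_compD.
      case: i => [|i]; first exact: extends0.
      apply: (@extends_weaken _ _ 0 _ S' _ (eq D`_i)) => //.
      by apply: extends_refl => p <-; apply: DS; eexists.
    rewrite -mulN1r; apply: extends_compM; first exact/affineN/affine1.
    by apply: ha; apply: DS; eexists.
  rewrite -mulN1r; apply: extends_compM; first exact/affineN/affine1.
  apply: extends_sum => u; rewrite mulrC; apply: hc; apply: WS.
  by exists u, i; split=> //; lia.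
have hall : extends (N.+2 * (N * kappa.+1 + kappa + 10) + 1)
    (fun p => (S p \/ isD p) \/ isW k p) (fun p => exists i, p = D'`_i).
  have h1 := extends_family (fun i : 'I_k.+2 => hD' (fun p => (S p \/ isD p) \/ isW k p) i
     (fun p e => or_introl (or_intror e)) (fun p e => or_intror e)).
  apply: extends_weaken (extends_trans h1 (@extends0 F m _)) => //.
    by rewrite card_ord leq_add2r leq_mul2r !ltnS (ltnW kN) orbT.
  move=> p [i ->]; case: (ltnP i k.+2) => ik; first by left; exists (Ordinal ik).
  by right; rewrite nth_default // size_char_poly.
have h2 := extends_trans hD (extends_trans (hW k _ (fun p e => or_intror e)) hall).
apply: extends_weaken h2 => //; last by move=> p; right; right.
rewrite mulSn addnC addnS ltnS leq_add2r /char_poly_cost leq_add2r leq_add2r.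
by rewrite leq_mul2r (ltnW kN) orbT.
Qed.

Lemma extends_det N kappa (M : 'M[R]_N) S :
  (forall i j, mul_cost kappa (M i j)) ->
  extends (N * char_poly_cost N kappa).+2 S (eq (\det M)).
Proof.
move=> hM; rewrite -addn1.
have -> : \det M = (-1) ^+ N * (char_poly M)`_0.
  by rewrite char_poly_det mulrA -exprMn mulrNN mulr1 expr1n mul1r.
have h1 := extends_char_poly (S := S) (leqnn N) hM.
have h2 : extends 1 (fun p => S p \/ exists i, p = (char_poly M)`_i)
   (eq ((-1) ^+ N * (char_poly M)`_0)).
  apply: extends_mul; last by right; exists 0%N.
  by rewrite -signr_odd; case: odd; rewrite ?expr0 ?expr1; [apply: affineN|]; apply: affine1.
by apply: extends_weaken (extends_trans h1 h2) => // p; right.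
Qed.
End CharPolyProgram.

(** * From skew programs to branching programs *)

Lemma sum_option (V : nmodType) (T : finType) (f : option T -> V) :
  \sum_v f v = f None + \sum_x f (Some x).
Proof.
rewrite (bigD1 None) //=; congr (_ + _).
rewrite (reindex_omap Some id) => [|[]] //=.
by apply: eq_bigl => x; rewrite eqxx.
Qed.

Section LayeredABP.
Variables (F : fieldType) (m : nat).
Local Notation R := {mpoly F[m]}.

Fixpoint path_sum (T : finType) (src : T) (lab : T -> T -> R) (k : nat) (v : T) : R :=
  if k is k'.+1 then \sum_u path_sum src lab k' u * lab u v else (v == src)%:R.

Lemma ABP_of_finType (T : finType) (lay : T -> nat) (src snk : T) (lab : T -> T -> R) :
  lay src = 0%N -> (forall v, lay v = 0%N -> v = src) ->
  (forall v, lay v = lay snk -> v = snk) -> (forall v, lay v <= lay snk)%N ->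
  (forall u v, lab u v = 0 \/ (lay v = (lay u).+1 /\ (msize (lab u v) <= 2)%N)) ->
  exists A : ABP F m, abp_poly A = path_sum src lab (lay snk) snk /\ abp_size A = #|T|.
Proof.
move=> h0 hsrc hsnk hle hlab; pose ev := @enum_val T xpredT.
have evK v : ev (enum_rank v) = v by apply: enum_rankK.
have @A : ABP F m.
  refine (@Build_ABP F m #|T| (fun i => lay (ev i)) (enum_rank src) (enum_rank snk)
    (fun i j => lab (ev i) (ev j)) _ _ _ _ _).
  - by rewrite evK.
  - by move=> v /hsrc <-; rewrite enum_valK.
  - by move=> v; rewrite evK => /hsnk <-; rewrite enum_valK.
  - by move=> v; rewrite evK.
  - by move=> u v; apply: hlab.
exists A; split=> //.
rewrite /abp_poly /=; set M := \matrix_(u, v) _.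
suff h k v : mxpow M k (enum_rank src) v = path_sum src lab k (ev v).
  by rewrite h !evK.
elim: k v => [|k IH] v /=; first by rewrite mxE -{2}(evK src) /ev (inj_eq enum_val_inj) eq_sym.
rewrite mxE [RHS](reindex _ (onW_bij _ (enum_val_bij T))) /=.
by apply: eq_bigr => u _; rewrite -/(mxpow M k) IH mxE.
Qed.

(** A product of [L] matrices between two vectors is a path sum through [L + 1] copies of ['I_N],
    with one source and one sink added. *)
Lemma layered_ABP N (Ms : seq 'M[R]_N) (u : 'rV[R]_N) (w : 'cV[R]_N) :
  (forall M, M \in Ms -> forall i j, affine (M i j)) ->
  (forall j, affine (u 0 j)) -> (forall i, affine (w i 0)) ->
  exists A : ABP F m, abp_poly A = (foldl mulmx u Ms *m w) 0 0 /\
    abp_size A = ((size Ms).+1 * N).+2.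
Proof.
move=> hMs hu hw; pose L := size Ms.
(* [None] is the source, [Some None] the sink, and [Some (Some (l, i))] is node [i] of layer
   [l + 1]. *)
pose T := option (option ('I_L.+1 * 'I_N)).
pose lay (v : T) := match v with None => 0%N | Some None => L.+2 | Some (Some li) => li.1.+1 end.
pose lab (v v' : T) : R := match v, v' with
  | None, Some (Some li) => if li.1 == 0 :> nat then u 0 li.2 else 0
  | Some (Some li), Some (Some lj) =>
      if (lj.1 == li.1.+1 :> nat) then nth 0 Ms li.1 li.2 lj.2 else 0
  | Some (Some li), Some None => if li.1 == L :> nat then w li.2 0 else 0
  | _, _ => 0 end.
have [|||||A [pA sA]] := @ABP_of_finType T lay None (Some None) lab.
- by [].
- by case=> // -[].
- by case=> // -[] // [[l hl] i] /= [el]; exfalso; move: (hl); rewrite el ltnn.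
- by case=> // -[] // [[l hl] i] /=; rewrite ltnS ltnW.
- case=> [[[l i]|]|] [[[l' i']|]|] /=; try by left.
  + case: eqP => [e|_]; [right | by left].
    by rewrite e; split=> //; apply: hMs; rewrite mem_nth // -ltnS -e.
  + by case: eqP => [->|_]; [right; split=> //; apply: hw | left].
  + by case: eqP => [->|_]; [right; split=> //; apply: hu | left].
exists A; split; last by rewrite sA !card_option card_prod !card_ord.
rewrite {}pA.
have big_opt (f : T -> R) : \sum_v f v =
    f None + (f (Some None) + \sum_(li : 'I_L.+1 * 'I_N) f (Some (Some li))).
  by rewrite !sum_option.
have big_layer l (hl : (l < L.+1)%N) (f : 'I_L.+1 -> 'I_N -> R) :
    \sum_(li : 'I_L.+1 * 'I_N) (if li.1 == l :> nat then f li.1 li.2 else 0) =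
    \sum_i f (Ordinal hl) i.
  rewrite -(pair_bigA _ (fun (l' : 'I_L.+1) (i : 'I_N) => if l' == l :> nat then f l' i else 0)) /=.
  rewrite (bigD1 (Ordinal hl)) //= eqxx [X in _ + X]big1 ?addr0 // => l' ne.
  rewrite big1 // => i _; case: eqP => // e; case/eqP: ne; exact: val_inj.
have stepE k (v : T) : path_sum (None : T) lab k.+1 v =
    \sum_u path_sum (None : T) lab k u * lab u v by [].
have hpath l (v : T) : (l <= L)%N -> path_sum (None : T) lab l.+1 v =
    if v is Some (Some li) then if li.1 == l :> nat then foldl mulmx u (take l Ms) 0 li.2 else 0
    else 0.
  elim: l v => [|l IH] v hl.
    rewrite /= big_opt /= mul1r mul0r add0r.
    rewrite big1 ?addr0; last by move=> li _; rewrite mul0r.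
    rewrite take0 /=.
    by case: v => [[li|]|].
  rewrite stepE big_opt !(IH _ (ltnW hl)) !mul0r !add0r.
  under eq_bigr => li _ do rewrite (IH _ (ltnW hl)).
  case: v => [[[l' j]|]|] /=; last first.
  - by rewrite big1 // => li _; rewrite mulr0.
  - rewrite big1 // => li _; case: eqP => [->|]; last by rewrite mul0r.
    by rewrite ltn_eqF // mulr0.
  case: (l' =P l.+1 :> nat) => [el|ne]; last first.
    rewrite big1 // => li _; case: eqP => [->|]; last by rewrite mul0r.
    by case: eqP => // _; rewrite mulr0.
  rewrite (take_nth 0) // foldl_rcons mxE.
  rewrite -(big_layer l (ltnW hl) (fun _ i => foldl mulmx u (take l Ms) 0 i * nth 0 Ms l i j)).
  apply: eq_bigr => li _; case: eqP => [->|]; last by rewrite mul0r.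
  by rewrite el eqxx.
rewrite stepE big_opt !hpath // !mul0r !add0r.
under eq_bigr => li _ do rewrite hpath //.
rewrite take_size mxE -(big_layer L (leqnn _) (fun _ i => foldl mulmx u Ms 0 i * w i 0)).
apply: eq_bigr => li _; rewrite /=; case: eqP => _; by rewrite ?mul0r.
Qed.

(** A row vector holds all results so far, zero beyond them. Each instruction is one matrix that
    copies the filled positions and writes the next; skewness makes the new column affine. *)
Lemma slp_layers (s : seq R) : slp s -> forall N, (size s <= N)%N ->
  exists Ms : seq 'M[R]_N, [/\ size Ms = (size s).-1,
    forall M, M \in Ms -> forall i j, affine (M i j) &
    foldl mulmx (\row_j (j == 0 :> nat)%:R) Ms = \row_j s`_j].
Proof.
have extend (t : seq R) N (M : 'M[R]_N) (x : R) (Ms : seq 'M[R]_N) (v : 'rV[R]_N) :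
    (size t < N)%N -> (0 < size t)%N ->
    size Ms = (size t).-1 -> (forall M, M \in Ms -> forall i j, affine (M i j)) ->
    foldl mulmx v Ms = \row_j t`_j -> forall col : 'I_N -> R, (forall i, affine (col i)) ->
    \sum_(i < N) t`_i * col i = x ->
    exists Ms : seq 'M[R]_N, [/\ size Ms = (size (rcons t x)).-1,
      forall M, M \in Ms -> forall i j, affine (M i j) &
      foldl mulmx v Ms = \row_j (rcons t x)`_j].
  move=> tN t0 sMs aMs eMs col acol ex.
  pose X : 'M[R]_N := \matrix_(i, j) if j == size t :> nat then col i else (i == j)%:R.
  exists (rcons Ms X); split.
  - by rewrite !size_rcons sMs; case: (size t) t0.
  - move=> Y; rewrite mem_rcons inE => /orP[/eqP -> i j|/aMs //].
    by rewrite mxE; case: ifP => // _; apply: affine_nat.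
  rewrite foldl_rcons eMs; apply/rowP => j; rewrite !mxE nth_rcons.
  case: ltngtP => jt.
  - rewrite (bigD1 j) //= !mxE ltn_eqF // eqxx mulr1 big1 ?addr0 // => i ij.
    by rewrite !mxE ltn_eqF // (negPf ij) mulr0.
  - rewrite big1 // => i _; rewrite !mxE gtn_eqF //; case: eqP => [->|]; last by rewrite mulr0.
    by rewrite nth_default ?mul0r // ltnW.
  - by rewrite -ex; apply: eq_bigr => i _; rewrite !mxE jt eqxx.
have pick (t : seq R) N p a : (size t < N)%N -> p \in t ->
    \sum_(i < N) t`_i * (if i == index p t :> nat then a else 0) = p * a.
  move=> tN pt; have hp : (index p t < N)%N by rewrite (leq_trans _ tN) // ltnW // ltnS index_mem.
  rewrite (bigD1 (Ordinal hp)) //= eqxx nth_index // big1 ?addr0 // => i ne.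
  case: eqP => [e|]; last by rewrite mulr0.
  by case/eqP: ne; apply: val_inj.
elim=> [|t a p ht IH ha pt|t p q ht IH pt qt] N sN.
- exists [::]; split=> //=; apply/rowP => j; rewrite !mxE.
  by case: (nat_of_ord j) => [|[]].
- rewrite size_rcons in sN; have [Ms [h1 h2 h3]] := IH N (ltnW sN).
  have t0 : (0 < size t)%N by case: (t) pt.
  apply: (extend t N 0 (a * p) Ms _ sN t0 h1 h2 h3 (fun i => if i == index p t :> nat then a else 0)).
    by move=> i; case: ifP => // _; apply: affine0.
  by rewrite pick // mulrC.
- rewrite size_rcons in sN; have [Ms [h1 h2 h3]] := IH N (ltnW sN).
  have t0 : (0 < size t)%N by case: (t) pt.
  (* The two indicators are added, so that [p = q] gives the label 2. *)
  apply: (extend t N 0 (p + q) Ms _ sN t0 h1 h2 h3 (fun i => (if i == index p t :> nat then 1 else 0) +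
      (if i == index q t :> nat then 1 else 0))).
    by move=> i; apply: affineD; case: ifP => _; [exact: affine1|exact: affine0|exact: affine1|exact: affine0].
  under eq_bigr => i _ do rewrite mulrDr.
  by rewrite big_split /= !pick // !mulr1.
Qed.

Lemma slp_ABP (s : seq R) p : slp s -> p \in s ->
  exists A : ABP F m, abp_poly A = p /\ (abp_size A <= (size s * size s).+2)%N.
Proof.
move=> hs ps; have [Ms [h1 h2 h3]] := slp_layers hs (leqnn _).
have [||A [hA sA]] := @layered_ABP _ Ms (\row_j (j == 0 :> nat)%:R)
   (\col_i (i == index p s :> nat)%:R) h2.
- by move=> j; rewrite mxE; apply: affine_nat.
- by move=> j; rewrite mxE; apply: affine_nat.
exists A; rewrite sA hA h1 h3; split.
  have hp : (index p s < size s)%N by rewrite index_mem.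
  rewrite mxE (bigD1 (Ordinal hp)) //= !mxE eqxx mulr1 nth_index // big1 ?addr0 // => i ne.
  rewrite !mxE; case: eqP => [e|]; last by rewrite mulr0.
  by case/eqP: ne; apply: val_inj.
by rewrite prednK //; case: (s) ps.
Qed.
End LayeredABP.

(** * The hard polynomial *)

(** Listing [A] before its complement and [B] before its complement, the permutation matches equal
    positions. *)
Lemma exists_perm_onto (T : finType) (A B : {set T}) : #|A| = #|B| ->
  exists s : {perm T}, forall x, (s x \in B) = (x \in A).
Proof.
move=> AB; pose l (C : {set T}) := enum C ++ enum (~: C).
have lmem C x : x \in l C by rewrite mem_cat !mem_enum inE orbN.
have luniq C : uniq (l C).
  rewrite cat_uniq !enum_uniq andbT /=; apply/hasPn => x.
  by rewrite !mem_enum inE.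
have lsize C : size (l C) = #|T| by rewrite size_cat -!cardE cardsC.
pose f x := nth x (l B) (index x (l A)).
have ilt x : (index x (l A) < size (l B))%N by rewrite lsize -(lsize A) index_mem.
have finj : injective f.
  move=> x y; rewrite /f (set_nth_default y x (ilt x)) => /eqP.
  rewrite nth_uniq // => /eqP e.
  by rewrite -(nth_index x (lmem A x)) e nth_index.
exists (perm finj) => x; rewrite permE /f.
rewrite nth_cat -cardE -AB; have := ilt x; rewrite lsize index_cat mem_enum.
case: ifP => xA.
  have hx : (index x (enum A) < #|A|)%N by rewrite cardE index_mem mem_enum.
  by move=> _; rewrite hx -mem_enum mem_nth // -cardE -AB.
rewrite -!cardE => hx; rewrite ltnNge leq_addr /= addKn; apply/negbTE/negP => h.
have := mem_nth x (_ : (index x (enum (~: A)) < size (enum (~: B)))%N).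
rewrite mem_enum inE h => /(_ _)/negP; apply=> //.
rewrite -cardE; have := cardsC B; rewrite -AB; lia.
Qed.

(** * Variables, blocks and multidegrees *)

Section Variables.
Variables (d n : nat).

(** The variables are the entries of a [d] by [n] matrix, one row per block, flattened by
    [mxvec_index]. *)
Definition vblk (j : 'I_(d * n)) : 'I_d := (enum_val (cast_ord (esym (mxvec_cast d n)) j)).1.
Definition vind (j : 'I_(d * n)) : 'I_n := (enum_val (cast_ord (esym (mxvec_cast d n)) j)).2.

Lemma vblkE b i : vblk (mxvec_index b i) = b.
Proof. by rewrite /vblk /mxvec_index cast_ordK enum_rankK. Qed.
Lemma vindE b i : vind (mxvec_index b i) = i.
Proof. by rewrite /vind /mxvec_index cast_ordK enum_rankK. Qed.
Lemma mxvec_index_eta j : mxvec_index (vblk j) (vind j) = j.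
Proof. by rewrite /mxvec_index /vblk /vind -surjective_pairing enum_valK cast_ordKV. Qed.

Lemma vblk_bounded : blocks_bounded n vblk.
Proof.
move=> b; rewrite -[leqRHS]card_ord -cardsT.
apply: leq_trans (leq_imset_card (mxvec_index b) _); apply: subset_leq_card.
apply/subsetP => j; rewrite inE => /eqP <-; apply/imsetP; exists (vind j) => //.
by rewrite mxvec_index_eta.
Qed.
End Variables.

Section MultiDegree.
Variables (F : fieldType) (m d : nat) (blk : 'I_m -> 'I_d).
Implicit Types (P Q : {mpoly F[m]}) (delta : 'I_d -> nat).

(** Set-multilinearity is the case of constant [delta] 1; general degrees are needed for factors
    that meet only some blocks. *)
Definition multidegree delta P : Prop :=
  forall mo : 'X_{1..m}, mo \in msupp P -> forall i, (\sum_(j < m | blk j == i) mo j)%N = delta i.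

Lemma multidegree_ext delta delta' P : delta =1 delta' ->
  multidegree delta P -> multidegree delta' P.
Proof. by move=> e hP mo hm i; rewrite -e hP. Qed.

Lemma multidegreeX j : multidegree (fun i => blk j == i) 'X_j.
Proof.
move=> mo; rewrite msuppX inE => /eqP -> i.
rewrite big_mkcond (bigD1 j) //= mnm1E eqxx big1 ?addn0; last first.
  by move=> j' ne; rewrite mnm1E [j == j']eq_sym (negPf ne); case: ifP.
by case: eqP.
Qed.

Lemma multidegreeM delta delta' P Q : multidegree delta P -> multidegree delta' Q ->
  multidegree (fun i => (delta i + delta' i)%N) (P * Q).
Proof.
move=> hP hQ mo /msuppM_le /allpairsP[[m1 m2] /= [h1 h2 ->]] i.
by under eq_bigr do rewrite mnmDE; rewrite big_split /= hP // hQ.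
Qed.

Lemma multidegree1 : multidegree (fun=> 0%N) 1.
Proof.
by move=> mo; rewrite msupp1 inE => /eqP -> i; rewrite big1 // => j _; rewrite mnm0E.
Qed.

Lemma multidegree_sum (I : finType) (p : pred I) delta (f : I -> {mpoly F[m]}) :
  (forall x, p x -> multidegree delta (f x)) -> multidegree delta (\sum_(x | p x) f x).
Proof.
move=> h; elim/big_ind: _ => [mo|P Q hP hQ mo /msuppD_le|//].
  by rewrite msupp0.
by rewrite mem_cat => /orP[/hP|/hQ].
Qed.

Lemma multidegree_prod (I : finType) (p : pred I) (delta : I -> 'I_d -> nat) (f : I -> {mpoly F[m]}) :
  (forall x, p x -> multidegree (delta x) (f x)) ->
  multidegree (fun i => \sum_(x | p x) delta x i)%N (\prod_(x | p x) f x).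
Proof.
move=> h; rewrite -big_filter; pose D i := (\sum_(x <- filter p (index_enum I)) delta x i)%N.
have DE i : (\sum_(x | p x) delta x i)%N = D i by rewrite /D big_filter.
move=> mo hm i; rewrite DE; move: mo hm i; rewrite /D.
have : forall x, x \in filter p (index_enum I) -> p x by move=> x; rewrite mem_filter => /andP[].
elim: (filter _ _) => [|x s IH] hs mo.
  by rewrite big_nil => /multidegree1 e i; rewrite e big_nil.
rewrite big_cons => hm i; rewrite big_cons.
have hs' : multidegree (fun i => \sum_(y <- s) delta y i)%N (\prod_(y <- s) f y).
  by move=> mo' hm' i'; apply: IH => // y ys; apply: hs; rewrite inE ys orbT.
exact: (multidegreeM (h x (hs x (mem_head _ _))) hs' hm i).
Qed.

Lemma multidegreeN delta P : multidegree delta P -> multidegree delta (- P).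
Proof. by move=> h mo; rewrite (perm_mem (msuppN P)) => /h. Qed.

Lemma multidegree_sign delta P (b : bool) :
  multidegree delta P -> multidegree delta ((-1) ^+ b * P).
Proof. by case: b => h; rewrite ?expr1 ?mulN1r ?mul1r //; apply: multidegreeN. Qed.
End MultiDegree.

(** * Roles of the blocks *)

Section BlockRoles.
Variable d : nat.
Let h := (d %/ 3)%N.

Lemma xb_proof (u : 'I_h) : (u < d)%N. Proof. by have := ltn_ord u; rewrite /h; lia. Qed.
Lemma yb_proof (u : 'I_h) : (h + u < d)%N. Proof. by have := ltn_ord u; rewrite /h; lia. Qed.
Lemma lb_proof (u : 'I_h) : (h + h + u < d)%N. Proof. by have := ltn_ord u; rewrite /h; lia. Qed.
Definition xb u : 'I_d := Ordinal (xb_proof u).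
Definition yb u : 'I_d := Ordinal (yb_proof u).
Definition lb u : 'I_d := Ordinal (lb_proof u).

Definition xyblocks : {set 'I_d} := [set b : 'I_d | (b < h + h)%N].

Lemma xb_inj : injective xb. Proof. by move=> u v /(congr1 val) /= e; apply: val_inj. Qed.
Lemma yb_inj : injective yb. Proof. by move=> u v /(congr1 val) /= /addnI e; apply: val_inj. Qed.
Lemma lb_inj : injective lb. Proof. by move=> u v /(congr1 val) /= /addnI e; apply: val_inj. Qed.

Lemma card_xyblocks_setI (c : {set 'I_d}) :
  #|c :&: xyblocks| = (#|[set u | xb u \in c]| + #|[set v | yb v \in c]|)%N.
Proof.
have -> : c :&: xyblocks = [set xb u | u in [set u | xb u \in c]] :|: [set yb u | u in [set v | yb v \in c]].
  apply/setP => b; rewrite !inE; apply/andP/orP => [[bc bh]|].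
    case: (ltnP b h) => hb; [left | right].
      have e : b = xb (Ordinal hb) by apply: val_inj.
      by rewrite e imset_f // inE -e.
    have hb' : (b - h < h)%N by lia.
    have e : b = yb (Ordinal hb') by apply: val_inj; rewrite /= subnKC.
    by rewrite e imset_f // inE -e.
  case=> /imsetP[u]; rewrite inE => uc ->; split=> //=; have := ltn_ord u; lia.
rewrite cardsU (card_imset _ xb_inj) (card_imset _ yb_inj).
have -> : [set xb u | u in [set u | xb u \in c]] :&: [set yb u | u in [set v | yb v \in c]] = set0.
  apply/setP => b; rewrite !inE; apply/andP => -[/imsetP[u _ ->] /imsetP[v _ /(congr1 val) /=]].
  have := ltn_ord u; lia.
by rewrite cards0 subn0.
Qed.

Lemma card_xyblocks : #|xyblocks| = h.*2.
Proof.
rewrite -[xyblocks]setTI card_xyblocks_setI -addnn.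
by congr addn; rewrite -[RHS]card_ord -cardsT; apply: eq_card => u; rewrite !inE.
Qed.

End BlockRoles.

Section HardPolynomial.
Variables (F : fieldType) (d n : nat).
Hypothesis dn : (d <= n)%N.
Let h := (d %/ 3)%N.

Lemma wd_proof : (h <= n)%N. Proof. by rewrite /h; lia. Qed.
(** Turns a column index into the index of a variable in an [l]-block. *)
Definition wd : 'I_h -> 'I_n := widen_ord wd_proof.

Definition var (b : 'I_d) (i : 'I_n) : {mpoly F[d * n]} := 'X_(mxvec_index b i).

Definition entry (u v : 'I_h) : {mpoly F[d * n]} :=
  var (lb u) (wd v) * \sum_i var (xb u) i * var (yb v) i.

Definition hard_poly : {mpoly F[d * n]} :=
  \det (\matrix_(u, v) entry u v) * \prod_(b < d | (3 * h <= b)%N) \sum_i var b i.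

Lemma multidegree_var b i : multidegree (@vblk d n) (fun i => b == i) (var b i).
Proof. by have := @multidegreeX F _ _ (@vblk d n) (mxvec_index b i); rewrite vblkE. Qed.

(** In the term of a permutation [s], row [u] brings the blocks [lb u], [xb u] and [yb (s u)]; as
    [s] is bijective, every block occurs once. *)
Lemma hard_poly_set_multilinear : set_multilinear (@vblk d n) hard_poly.
Proof.
pose delta i := (\sum_(u < h) ((lb u == i) + ((xb u == i) + (yb u == i))) +
   \sum_(b < d | (3 * h <= b)%N) (b == i))%N.
have hdelta : multidegree (@vblk d n) delta hard_poly.
  apply: multidegreeM; last first.
    apply: multidegree_prod => b _; apply: multidegree_sum => i _; exact: multidegree_var.
  rewrite /determinant; apply: multidegree_sum => s _; apply: multidegree_sign.
  apply: (@multidegree_ext _ _ _ _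
     (fun i => \sum_(u < h) ((lb u == i) + ((xb u == i) + (yb (s u) == i))))%N).
    move=> i; rewrite !big_split /=; congr (_ + (_ + _))%N.
    by rewrite [RHS](reindex_inj (@perm_inj _ s)).
  apply: multidegree_prod => u _; rewrite mxE; apply: multidegreeM; first exact: multidegree_var.
  by apply: multidegree_sum => i _; apply: multidegreeM; apply: multidegree_var.
move=> mo /hdelta hm i; rewrite hm /delta !big_split /=.
(* Each role fills an interval of [h] indices, and these intervals together with the padding tile
   ['I_d]. *)
have count (c : nat) (f : 'I_h -> 'I_d) : (forall u, f u = (c + u)%N :> nat) ->
    (\sum_(u < h) (f u == i) = (c <= i < c + h))%N.
  move=> fE; case: (boolP (c <= i < c + h)%N) => [/andP[ci ich]|ne].
    have uh : (i - c < h)%N by lia.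
    rewrite (bigD1 (Ordinal uh)) //= big1 => [|u ne].
      by rewrite -(inj_eq val_inj) /= fE /= subnKC ?eqxx.
    apply/eqP; rewrite eqb0 -(inj_eq val_inj) /= fE; apply: contra ne => /eqP e.
    by rewrite -val_eqE /= -e addKn.
  apply: big1 => u _; apply/eqP; rewrite eqb0 -(inj_eq val_inj) /= fE; apply: contra ne => /eqP <-.
  by rewrite leq_addr ltn_add2l ltn_ord.
rewrite (count 0%N (@xb d)) // (count h (@yb d)) // (count (h + h)%N (@lb d)) //.
have -> : (\sum_(b < d | 3 * h <= b) (b == i) = (3 * h <= i))%N.
  rewrite big_mkcond (bigD1 i) //= eqxx big1 ?addn0; first by case: leqP.
  by move=> b /negPf ->; case: ifP.
have := ltn_ord i; lia.
Qed.

(** Each of the [n] summands takes three multiplications by variables and one addition; the initial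
    0 makes it 4n + 1. *)
Lemma extends_entry u v : mul_cost (4 * n).+1 (entry u v).
Proof.
move=> S p Sp; rewrite /entry mulrC mulrA big_distrr /=.
have h3 (i : 'I_n) : extends 3 S (eq (p * var (lb u) (wd v) * (var (xb u) i * var (yb v) i))).
  have -> : p * var (lb u) (wd v) * (var (xb u) i * var (yb v) i) =
    var (yb v) i * (var (xb u) i * (var (lb u) (wd v) * p)) by ring.
  do 2!(apply: extends_compM; first exact: affineX).
  by apply: extends_mul => //; apply: affineX.
by apply: extends_weaken (extends_sum h3) => //; rewrite card_ord mulnC.
Qed.

Lemma hard_poly_computable :
  exists s, [/\ slp s, (size s <= 1 + ((h * char_poly_cost h (4 * n).+1).+2 + d))%N &
    hard_poly \in s].
Proof.
pose S0 (p : {mpoly F[d * n]}) := False.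
have hdet : extends (h * char_poly_cost h (4 * n).+1).+2 S0 (eq (\det (\matrix_(u, v) entry u v))).
  by apply: extends_det => i j; rewrite mxE; apply: extends_entry.
have hprod : extends ((h * char_poly_cost h (4 * n).+1).+2 + d) S0 (eq hard_poly).
  rewrite /hard_poly mulrC; set D := \det _ in hdet *.
  rewrite -[prod in prod * _]big_filter; set l := [seq _ <- _ | _].
  have ld : (size l <= d)%N by rewrite -sum1_size big_filter sum1_card (leq_trans (max_card _)) ?card_ord.
  apply: (@extends_weaken _ _ ((h * char_poly_cost h (4 * n).+1).+2 + size l) _
     S0 _ _ _ _ _ (fun p e => e)) => //; first by rewrite leq_add2l.
  elim: l {ld} => [|b l IH]; first by rewrite big_nil mul1r addn0.
  rewrite big_cons -mulrA addnS; apply: extends_compM => //.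
  by apply: affine_sum => i _; apply: affineX.
have [//||s [hs sz mem]] := hprod 1%N S0.
  by exists [:: 1]; split=> //; apply: slp_one.
by exists s; split=> //; apply: mem; right.
Qed.

Definition hard_point (g : 'I_d -> 'I_n) : 'I_(d * n) -> F := unit_point F (@vblk d n) (@vind d n) g.

Lemma var_eval g b i : (var b i).@[hard_point g] = (g b == i)%:R.
Proof. by rewrite mevalXU /hard_point /unit_point vblkE vindE. Qed.

(** Freezing the [l]-blocks to [s] kills every entry off the graph of [s], so one term of the
    determinant survives. A padding factor has exactly one variable equal to 1. *)
Lemma hard_poly_eval (g : 'I_d -> 'I_n) (s : 'S_h) : (forall u, g (lb u) = wd (s u)) ->
  hard_poly.@[hard_point g] = (-1) ^+ s * \prod_u (g (xb u) == g (yb (s u)))%:R.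
Proof.
move=> gs; rewrite /hard_poly mevalM.
have sum_pick b (f : 'I_n -> F) : \sum_i (g b == i)%:R * f i = f (g b).
  rewrite (bigD1 (g b)) //= eqxx mul1r big1 ?addr0 // => i /negPf ne.
  by rewrite eq_sym ne mul0r.
have -> : (\prod_(b < d | (3 * h <= b)%N) \sum_i var b i).@[hard_point g] = 1.
  rewrite rmorph_prod big1 // => b _; rewrite /= raddf_sum /=.
  rewrite -[RHS](sum_pick b (fun=> 1)); apply: eq_bigr => i _; by rewrite var_eval mulr1.
rewrite mulr1 -det_map_mx.
have entryE u v : (entry u v).@[hard_point g] = (s u == v)%:R * (g (xb u) == g (yb v))%:R.
  have wdE : (wd (s u) == wd v) = (s u == v).
    by apply/eqP/eqP => [/(congr1 val) /= e|->//]; apply: val_inj.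
  rewrite mevalM var_eval gs wdE; congr (_ * _); rewrite raddf_sum /=; under eq_bigr do rewrite mevalM !var_eval.
  by rewrite sum_pick eq_sym.
rewrite /determinant (bigD1 s) //= [X in _ + X]big1 ?addr0 => [|s' ne].
  by congr (_ * _); apply: eq_bigr => u _; rewrite !mxE /= entryE eqxx mul1r.
have [u hu] : exists u, s u != s' u.
  by apply/existsP; apply: contraR ne; rewrite negb_exists => /forallP e; apply/eqP/permP => u; apply/esym/eqP; rewrite -[_ == _]negbK.
by rewrite (bigD1 u) //= !mxE /= entryE (negPf hu) !mul0r mulr0.
Qed.

(** By balance, [c] contains as many [x]-blocks as it misses [y]-blocks, so some [s] gives [xb u]
    and [yb (s u)] different colours. One is then read from [f] and the other from [f'], both at
    [u], and the product tests [f = f']. *)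
Lemma hard_poly_full_rank (c : {set 'I_d}) : (0 < h)%N -> #|c :&: xyblocks d| = h ->
  exists (rho : 'I_d -> 'I_h) (g0 : 'I_d -> 'I_n) (a : F), a != 0 /\
    forall f f' : {ffun 'I_h -> 'I_n},
      hard_poly.@[hard_point (glue (xyblocks d) c rho g0 f f')] = a * (f == f')%:R.
Proof.
move=> h0; rewrite card_xyblocks_setI => bal.
have [s hs] : exists s : 'S_h, forall u, (s u \in [set v | yb v \notin c]) = (u \in [set u | xb u \in c]).
  apply: exists_perm_onto.
  have := cardsC [set v | yb v \in c]; rewrite card_ord.
  have -> : ~: [set v | yb v \in c] = [set v | yb v \notin c] by apply/setP => v; rewrite !inE.
  move=> e; apply/eqP; rewrite -(eqn_add2r #|[set v | yb v \in c]|) bal.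
  by rewrite [X in _ == X]addnC e.
pose u0 := Ordinal h0.
(* [rho] labels both [xb u] and [yb (s u)] by [u]; the default [u0] is reached only at blocks of
   other roles. *)
pose rho b := odflt u0 [pick u | (xb u == b) || (yb (s u) == b)].
pose g0 b := odflt (wd u0) (omap (fun u => wd (s u)) [pick u | lb u == b]).
have rhox u : rho (xb u) = u.
  rewrite /rho; case: pickP => [u' /orP[/eqP/xb_inj //|/eqP/(congr1 val) /=]|/(_ u)]; last by rewrite eqxx.
  have := ltn_ord u; lia.
have rhoy u : rho (yb (s u)) = u.
  rewrite /rho; case: pickP => [u' /orP[/eqP/(congr1 val) /=|/eqP/yb_inj/perm_inj //]|/(_ u)]; last by rewrite eqxx orbT.
  have := ltn_ord u'; lia.
have g0l u : g0 (lb u) = wd (s u).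
  by rewrite /g0; case: pickP => [u' /eqP/lb_inj -> //|/(_ u)]; rewrite eqxx.
exists rho, g0, ((-1) ^+ s); split; first by rewrite signr_eq0.
move=> f f'; rewrite (@hard_poly_eval _ s); last first.
  by move=> u; rewrite /glue inE /= ltnNge leq_addr /=.
congr (_ * _).
have gl u : (glue (xyblocks d) c rho g0 f f' (xb u) == glue (xyblocks d) c rho g0 f f' (yb (s u))) = (f u == f' u).
  have xin : xb u \in xyblocks d by rewrite inE /=; apply: leq_trans (ltn_ord u) (leq_addr _ _).
  have yin : yb (s u) \in xyblocks d by rewrite inE /= ltn_add2l ltn_ord.
  rewrite /glue xin yin rhox rhoy; have := hs u; rewrite !inE => <-.
  by case: (yb (s u) \in c) => //=; rewrite eq_sym.
under eq_bigr do rewrite gl.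
case: eqP => [->|ne]; first by rewrite big1 // => u _; rewrite eqxx.
have [u hu] : exists u, f u != f' u.
  apply/existsP; apply: contra_notT ne; rewrite negb_exists => /forallP e.
  by apply/ffunP => u; apply/eqP; rewrite -[_ == _]negbK.
by rewrite (bigD1 u) //= (negPf hu) mul0r.
Qed.
End HardPolynomial.

(** * Numerical estimates and choice of parameters *)

Lemma char_poly_cost_bound h d n : (16 <= n)%N -> (h <= n)%N -> (d <= n)%N ->
  (1 + ((h * char_poly_cost h (4 * n).+1).+2 + d) <= n ^ 9)%N.
Proof.
move=> n16 hn dn; have n0 : (0 < n)%N by lia.
have e2 : (n ^ 2 = n * n)%N by rewrite expnS expn1.
have kap : ((4 * n).+1.+1 <= n ^ 2)%N by rewrite e2; nia.
have kap' : ((4 * n).+1 + 10 <= n ^ 2)%N by rewrite e2; nia.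
have mon a b x y : (x <= n ^ a)%N -> (y <= n ^ b)%N -> (x * y <= n ^ (a + b))%N.
  by move=> *; rewrite expnD leq_mul.
have dbl a x y : (x <= n ^ a)%N -> (y <= n ^ a)%N -> (x + y <= n ^ a.+1)%N.
  by move=> hx hy; rewrite expnS; apply: leq_trans (leq_add hx hy) _; nia.
have h1 : (h <= n ^ 1)%N by rewrite expn1.
have pw a b : (a <= b)%N -> (n ^ a <= n ^ b)%N by move=> ab; rewrite leq_pexp2l.
have one a : (1 <= n ^ a)%N by rewrite expn_gt0 n0.
have A1 : (h * (4 * n).+2 <= n ^ 3)%N by exact: (mon 1%N 2%N).
have A2 : (h * (4 * n).+2 + (4 * n).+1 + 10 <= n ^ 4)%N.
  rewrite -addnA; apply: dbl => //; apply: leq_trans kap' (pw _ _ _); lia.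
have A3 : (h * (4 * n).+2 + (4 * n).+1 + 3 <= n ^ 4)%N by apply: leq_trans A2; rewrite leq_add2l.
have B1 := dbl _ _ _ (mon _ _ _ _ h1 (mon _ _ _ _ h1 A3)) (one 6).
have h2 : (h.+2 <= n ^ 2)%N by rewrite e2; nia.
have B2 := dbl _ _ _ (mon _ _ _ _ h2 A2) (one 6).
have C2 : (char_poly_cost h (4 * n).+1 <= 2 * n ^ 7)%N.
  by rewrite /char_poly_cost mul2n -addnn leq_add.
have C3 : (h * char_poly_cost h (4 * n).+1 <= 2 * n ^ 8)%N.
  by rewrite expnS mulnCA leq_mul.
have C4 : (n <= n ^ 8)%N by rewrite -{1}(expn1 n); apply: pw.
rewrite expnS; apply: (@leq_trans (16 * n ^ 8)%N); last by rewrite leq_mul2r n16 orbT.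
move: C3 C4 dn n16; clear; set x := (h * _)%N; set y := (n ^ 8)%N; lia.
Qed.

Lemma linear_le_exp2 K : exists r0, forall r, (r0 <= r)%N -> (K * r.+1 <= 2 ^ r)%N.
Proof.
(* At [r = 3K] the power is 2^K * 4^K, which dominates K(3K+1); from there on doubling beats adding
   [K]. *)
exists (3 * K)%N.
have lin x : (3 * x < 4 ^ x)%N by elim: x => // x IH; rewrite expnS; lia.
have base : (K * (3 * K).+1 <= 2 ^ (3 * K))%N.
  have -> : (2 ^ (3 * K) = 2 ^ K * 4 ^ K)%N by rewrite expnM -expnMn.
  by apply: leq_mul (lin K); rewrite ltnW // ltn_expl.
elim=> [|r IH]; first by rewrite leqn0 => /eqP e; rewrite e in base.
rewrite leq_eqVlt ltnS => /orP[/eqP <- //|/[dup] rK /IH {}IH].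
have : (K <= 2 ^ r)%N by apply: leq_trans IH; rewrite leq_pmulr.
by rewrite expnS; lia.
Qed.

(** Each program has its source in layer 0 and so width at least 1. *)
Lemma size_le_total_width F m d (blk : 'I_m -> 'I_d) (As : seq (smABP F blk)) :
  (size As <= total_width As)%N.
Proof.
rewrite /total_width -sum1_size; apply: leq_sum => A _.
apply: leq_trans (leq_bigmax ord0); apply/card_gt0P; exists (sm_src A).
by rewrite inE; apply/eqP; apply/(sm_first _).
Qed.

(* d = d(n) is a function of n with d = omega(log n) and d <= n. *)
Theorem theorem1p7 (F : fieldType) (d : nat -> nat)
  (hd_omega : forall C : nat, exists N : nat, forall n : nat,
      (N <= n)%N -> (C * trunc_log 2 n <= d n)%N)
  (hd_le : forall n : nat, (d n <= n)%N) :
  exists (m : nat -> nat) (blk : forall n : nat, 'I_(m n) -> 'I_(d n))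
         (G : forall n : nat, {mpoly F[m n]}),
    (exists c N : nat, forall n : nat, (N <= n)%N ->
       [/\ blocks_bounded n (blk n),
           set_multilinear (blk n) (G n) &
           exists A : ABP F (m n), abp_poly A = G n /\ (abp_size A <= n ^ c)%N])
    /\
    (forall k : nat, exists c N : nat, (0 < c)%N /\
       forall n : nat, (N <= n)%N ->
       forall As : seq (smABP F (blk n)),
         sum_poly As = G n -> (max_width As <= n ^ k)%N ->
         (2 ^ d n <= total_width As ^ c)%N).
Proof.
exists (fun n => (d n * n)%N), (fun n => @vblk (d n) n), (fun n => hard_poly F (hd_le n)).
split.
  (* The straight-line program has size at most n^9; unfolding squares this, and the two extra nodes
     fit into one more factor [n]. *)
  exists 19%N, 16%N => n n16; split; [exact: vblk_bounded | exact: hard_poly_set_multilinear |].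
  have [s [hs sz Gs]] := hard_poly_computable F (hd_le n).
  have [A [pA sA]] := slp_ABP hs Gs; exists A; split=> //.
  have hn : (d n %/ 3 <= n)%N by have := hd_le n; lia.
  have {}sz := leq_trans sz (char_poly_cost_bound n16 hn (hd_le n)).
  apply: leq_trans sA _; apply: (@leq_trans (n ^ 9 * n ^ 9).+2).
    by rewrite !ltnS leq_mul.
  rewrite -expnD expnS; have : (0 < n ^ 18)%N by rewrite expn_gt0; apply/orP; left; lia.
  nia.
(* [M] depends on [k] only; the exponent is the one of [Mlarge]. *)
move=> k; have [M [M0 hM]] := central_bin_small (k.*2.+1).+3.
have [r0 hr0] := linear_le_exp2 (4 * M).
(* As the logarithm is at least 1, this gives d >= 6M(r0+1); dividing by 3, [M] and 2 in turn leaves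
   [r > r0]. *)
have [N hN] := hd_omega (6 * M * r0.+1)%N.
(* The three roundings d < 3(h+1), h < M(q+1) and q <= 2r+1 give d <= 15Mr, since r >= 1. *)
exists (15 * M)%N, (maxn N 2); split; first by rewrite muln_gt0.
move=> n; rewrite geq_max => /andP[/hN dn n2] As GA wA.
set h := (d n %/ 3)%N; set q := (h %/ M)%N; pose r := (q %/ 2)%N.
have dlarge : (6 * M * r0.+1 <= d n)%N.
  apply: leq_trans dn; rewrite leq_pmulr //; exact: (@leq_trans (trunc_log 2 2)) (leq_trunc_log _ n2).
have hlarge : (2 * M * r0.+1 <= h)%N by rewrite /h leq_divRL //; lia.
have qlarge : (2 * r0.+1 <= q)%N by rewrite /q leq_divRL //; lia.
have rlarge : (r0.+1 <= r)%N by rewrite /r; lia.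
have hq : (h < M * q.+1)%N by rewrite mulnC ltn_ceil.
have q0 : (0 < q)%N by lia.
have h0 : (0 < h)%N by apply: leq_trans hlarge; rewrite !muln_gt0 M0.
have key : (2 ^ q <= h.*2 * size As)%N.
  have := @sum_smABP_size F _ (d n) n h _ (@vind (d n) n) _ k M n2 (card_xyblocks (d n)) M0 hM q0 As wA.
  apply=> c hc.
  have [rho [g0 [a [a0 e]]]] := hard_poly_full_rank F (hd_le n) h0 hc.
  by exists rho, g0, a; split=> // f f'; rewrite GA; apply: e.
(* Half of the exponent [q] absorbs the factor 2h <= 4M(r+1) <= 2^r; the other half bounds the
   number of programs. *)
have rt : (2 ^ r <= size As)%N.
  rewrite -(leq_pmul2l (_ : 0 < 2 ^ r)%N) ?expn_gt0 // -expnD.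
  apply: (@leq_trans (2 ^ q)%N); first by rewrite leq_pexp2l // /r; lia.
  apply: leq_trans key _; rewrite leq_mul2r; apply/orP; right.
  apply: leq_trans (hr0 r (ltnW rlarge)); rewrite /r; nia.
have dr : (d n <= 15 * M * r)%N.
  have : (d n < 3 * h.+1)%N by rewrite mulnC /h ltn_ceil.
  have : (q <= r.*2.+1)%N by rewrite /r; lia.
  nia.
apply: (@leq_trans (2 ^ (r * (15 * M)))%N); first by rewrite leq_pexp2l // mulnC.
rewrite expnM leq_exp2r ?muln_gt0 //.
exact: leq_trans rt (size_le_total_width As).
Qed.
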